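(* Let $\Gamma$ be a finitely generated group with a finite symmetric generating set $S$, and let $\rho\colon\Gamma\curvearrowright\mathcal H$ be an affine action on a Hilbert space, $\rho(\gamma)(\mathbf v)=A(\gamma)\mathbf v+b(\gamma)$, satisfying $\|A(\gamma)\|\le C\,l_{\mathrm{conj}}([\gamma])^\sigma$ for all $\gamma\ne e$, for some $C>0$, $\sigma\ge0$. Suppose $\rho(\Gamma)$ has no fixed point. Then there exist a Hilbert space $\mathcal H'$, an affine action $\rho'\colon\Gamma\curvearrowright\mathcal H'$ with linear parts $A'$ satisfying $\|A'(\gamma)\|\le C\,l_{\mathrm{conj}}([\gamma])^\sigma$ for all $\gamma\neq e$ (same $C,\sigma$), and a nonconstant harmonic $\rho'$-equivariant map $f\colon\Gamma\to\mathcal H'$.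
   Context: $l$ is word length w.r.t. $S$; $l_{\mathrm{conj}}(c)=\inf_{\gamma\in c}l(\gamma)$ for a conjugacy class $c$, $[\gamma]$ the class of $\gamma$. A map $f\colon\Gamma\to\mathcal H$ is $\rho$-equivariant if $f(\gamma x)=\rho(\gamma)(f(x))$ for all $\gamma,x\in\Gamma$. It is harmonic if $\frac1{\#S}\sum_{s\in S}f(xs)=f(x)$ for all $x\in\Gamma$. *)

(* Defs.v *)
From Stdlib Require Import Reals List ClassicalEpsilon.
Open Scope R_scope.

Record is_group (G : Type) (mul : G -> G -> G) (inv : G -> G) (e : G) : Prop := {
  grp_assoc : forall x y z, mul x (mul y z) = mul (mul x y) z;
  grp_idl : forall x, mul e x = x;
  grp_idr : forall x, mul x e = x;
  grp_invl : forall x, mul (inv x) x = e;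
  grp_invr : forall x, mul x (inv x) = e
}.

Definition word_prod {G : Type} (mul : G -> G -> G) (e : G) (w : list G) : G :=
  fold_right mul e w.

Definition finite_symmetric_generating_set {G : Type} (mul : G -> G -> G)
  (inv : G -> G) (e : G) (S : list G) : Prop :=
  NoDup S /\ (forall s, In s S -> In (inv s) S) /\
  (forall g, exists w, Forall (fun s => In s S) w /\ word_prod mul e w = g).

Definition nat_inf (P : nat -> Prop) : nat :=
  epsilon (inhabits 0%nat) (fun n => P n /\ forall m, P m -> (n <= m)%nat).

Definition word_length {G : Type} (mul : G -> G -> G) (e : G) (S : list G) (g : G) : nat :=
  nat_inf (fun n => exists w, length w = n /\ Forall (fun s => In s S) w /\
                               word_prod mul e w = g).

Definition conj_length {G : Type} (mul : G -> G -> G) (inv : G -> G) (e : G)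
  (S : list G) (g : G) : nat :=
  nat_inf (fun n => exists h, word_length mul e S (mul (mul h g) (inv h)) = n).

Record Hilbert : Type := {
  hcar :> Type;
  hadd : hcar -> hcar -> hcar;
  hzero : hcar;
  hopp : hcar -> hcar;
  hscal : R -> hcar -> hcar;
  hinner : hcar -> hcar -> R;
  h_add_assoc : forall x y z, hadd x (hadd y z) = hadd (hadd x y) z;
  h_add_comm : forall x y, hadd x y = hadd y x;
  h_add_0 : forall x, hadd x hzero = x;
  h_add_opp : forall x, hadd x (hopp x) = hzero;
  h_scal_1 : forall x, hscal 1 x = x;
  h_scal_assoc : forall a b x, hscal a (hscal b x) = hscal (a * b) x;
  h_scal_distr_v : forall a x y, hscal a (hadd x y) = hadd (hscal a x) (hscal a y);
  h_scal_distr_s : forall a b x, hscal (a + b) x = hadd (hscal a x) (hscal b x);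
  h_inner_sym : forall x y, hinner x y = hinner y x;
  h_inner_add : forall x y z, hinner (hadd x y) z = hinner x z + hinner y z;
  h_inner_scal : forall a x y, hinner (hscal a x) y = a * hinner x y;
  h_inner_pos : forall x, 0 <= hinner x x;
  h_inner_def : forall x, hinner x x = 0 -> x = hzero;
  h_complete : forall u : nat -> hcar,
    (forall eps, 0 < eps -> exists N, forall m n, (N <= m)%nat -> (N <= n)%nat ->
        sqrt (hinner (hadd (u m) (hopp (u n))) (hadd (u m) (hopp (u n)))) < eps) ->
    exists l, forall eps, 0 < eps -> exists N, forall n, (N <= n)%nat ->
        sqrt (hinner (hadd (u n) (hopp l)) (hadd (u n) (hopp l))) < eps
}.

Arguments hadd {h}. Arguments hzero {h}. Arguments hopp {h}.
Arguments hscal {h}. Arguments hinner {h}.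

Definition hnorm {H : Hilbert} (x : H) : R := sqrt (hinner x x).

Definition is_linear {H : Hilbert} (T : H -> H) : Prop :=
  (forall x y, T (hadd x y) = hadd (T x) (T y)) /\
  (forall a x, T (hscal a x) = hscal a (T x)).

Definition opnorm_le {H : Hilbert} (T : H -> H) (K : R) : Prop :=
  forall v, hnorm (T v) <= K * hnorm v.

Definition bounded_linear {H : Hilbert} (T : H -> H) : Prop :=
  is_linear T /\ exists K, opnorm_le T K.

Definition affine_action {G : Type} (mul : G -> G -> G) (e : G) (H : Hilbert)
  (rho : G -> H -> H) (A : G -> H -> H) (b : G -> H) : Prop :=
  (forall g, bounded_linear (A g)) /\
  (forall g v, rho g v = hadd (A g v) (b g)) /\
  (forall v, rho e v = v) /\
  (forall g h v, rho (mul g h) v = rho g (rho h v)).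

Definition linear_growth_bound {G : Type} (mul : G -> G -> G) (inv : G -> G) (e : G)
  (S : list G) (H : Hilbert) (A : G -> H -> H) (C sigma : R) : Prop :=
  forall g, g <> e -> opnorm_le (A g) (C * Rpower (INR (conj_length mul inv e S g)) sigma).

Definition has_fixed_point {G : Type} {H : Hilbert} (rho : G -> H -> H) : Prop :=
  exists v, forall g, rho g v = v.

Definition equivariant {G : Type} (mul : G -> G -> G) {H : Hilbert}
  (rho : G -> H -> H) (f : G -> H) : Prop :=
  forall g x, f (mul g x) = rho g (f x).

Definition hsum {H : Hilbert} (l : list H) : H := fold_right hadd hzero l.

Definition harmonic {G : Type} (mul : G -> G -> G) (S : list G) {H : Hilbert}
  (f : G -> H) : Prop :=
  forall x, hscal (/ INR (length S)) (hsum (map (fun s => f (mul x s)) S)) = f x.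

Definition nonconstant {G : Type} {H : Hilbert} (f : G -> H) : Prop :=
  exists x y, f x <> f y.

(* Main.v *)
(** Let P v be the mean of rho(s) v over S and L its linear part; the orbit map of v is
harmonic iff P v = v, and the bound on A makes the iterates of L grow subexponentially.
If P v = v fails for all v, then the solutions v of mu v = L v + P 0 are unbounded as mu
decreases to 1, so that w = P v - v = (mu - 1) v satisfies
L w - w = (mu - 1) (w - P 0) = o(|w|). If |P v - v| is not bounded below by a multiple of the
displacements |rho(s) v - v|, an ultralimit of rescalings of the action has a nonconstant
harmonic orbit. Otherwise rescale by |w|: in the ultralimit P' 0 = w' is nonzero with
L' w' = w'. Either w' is not A'-invariant, and its orbit under A' is harmonic and nonconstant,
or w' is invariant and the action induced on the quotient by w' has 0 as a harmonic point,
which the symmetry of S prevents from being fixed. *)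

Require Import Defs.
From Stdlib Require Import Reals List Lra Lia ClassicalEpsilon
  FunctionalExtensionality PropExtensionality ProofIrrelevance Permutation Wf_nat.
From mathcomp Require filter.
Open Scope R_scope.

(** * Elementary lemmas *)

(** For isometric actions a harmonic orbit is found by minimising an energy. Here the norms of the
    [A g] may tend to infinity, and the first variation of an energy is no longer harmonicity. What
    survives is spectral: a power of L averages the [A g] over words of a given length, so
    polynomial growth leaves L with spectral radius at most 1, and the equation for mu is solvable
    for every mu > 1. If the solutions stayed bounded, they would be almost fixed by P in a ball,
    and weak compactness, in the form of nearly minimal norms on nested closed convex sets, would
    give a fixed point of P. An ultralimit of cocycles exists only if the generator displacements
    stay bounded at the scale of the rescaling. The largest displacement is always such a scale, |w|
    only under a gap; hence the dichotomy. The constants C and sigma persist because moving the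
    origin and dilating leave [A] unchanged, while ultralimits and the quotient by an invariant
    vector do not increase the norm of any single [A g]. *)

Lemma nat_inf_le (P : nat -> Prop) n : P n -> (nat_inf P <= n)%nat.
Proof.
intro HP. unfold nat_inf.
destruct (epsilon_spec (inhabits 0%nat) (fun n => P n /\ forall m, P m -> (n <= m)%nat))
  as [_ Hmin].
- destruct (dec_inh_nat_subset_has_unique_least_element P) as [m [Hm _]].
  + intro; apply classic.
  + exists n; exact HP.
  + exists m; exact Hm.
- apply Hmin, HP.
Qed.

Lemma inv_index_small eps : 0 < eps -> exists N, forall k, (N <= k)%nat -> / (INR k + 1) < eps.
Proof.
intro He. destruct (archimed_cor1 eps He) as [N [HN HN0]]. exists N; intros k Hk.
apply Rlt_trans with (2 := HN). apply lt_0_INR in HN0. apply le_INR in Hk.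
apply Rinv_lt_contravar; [nra|lra].
Qed.

Lemma exp_le_mono x y : x <= y -> exp x <= exp y.
Proof. intros [Hlt| ->]; [apply Rlt_le, exp_increasing, Hlt|apply Rle_refl]. Qed.

Lemma ln_le_mono x y : 0 < x -> x <= y -> ln x <= ln y.
Proof. intros Hx [Hlt| ->]; [apply Rlt_le, ln_increasing; assumption|apply Rle_refl]. Qed.

Lemma Rpower_INR_le m n sigma :
  0 <= sigma -> (m <= n)%nat -> Rpower (INR m) sigma <= Rpower (INR (n + 1)) sigma.
Proof.
intros Hs Hmn. apply exp_le_mono, Rmult_le_compat_l; [assumption|].
assert (1 <= INR (n + 1)) by (rewrite plus_INR; simpl; pose proof (pos_INR n); lra).
destruct m as [|m].
(* [ln 0] is 0 by default, hence [Rpower (INR 0) sigma] is 1 and [m = 0] behaves like base 1, which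
   is at most [n + 1]. *)
- replace (ln (INR 0)) with 0.
  + rewrite <- ln_1. apply ln_le_mono; lra.
  + unfold ln. destruct (Rlt_dec 0 (INR 0)) as [Hlt|]; [elim (Rlt_irrefl _ Hlt)|reflexivity].
- apply ln_le_mono; [apply lt_0_INR; lia|apply le_INR; lia].
Qed.

(** The graph of [ln] lies below its tangent at [/ a]; the slope [a] is free and is taken small in
    the next lemma. *)
Lemma ln_le_linear a x : 0 < a -> 0 < x -> ln x <= a * x - 1 - ln a.
Proof.
intros Ha Hx. pose proof (exp_ineq1_le (ln (a * x))) as E.
rewrite exp_ln, ln_mult in E by nra. lra.
Qed.

Lemma Rpower_INR_le_pow sigma q : 0 <= sigma -> 1 < q ->
  exists K, 0 <= K /\ forall n, Rpower (INR (n + 1)) sigma <= K * q ^ n.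
Proof.
intros Hs Hq. assert (Hd : 0 < ln q) by (rewrite <- ln_1; apply ln_increasing; lra).
(* This slope gives [sigma * a <= ln q], also when [sigma] is 0. The tangent bound becomes [sigma *
   ln (n + 1) <= (n + 1) * ln q + sigma * (- 1 - ln a)], from which the constant is read off. *)
pose (a := ln q / (sigma + 1)).
assert (Ha : 0 < a) by (apply Rdiv_lt_0_compat; lra).
exists (exp (ln q + sigma * (- 1 - ln a))). split; [apply Rlt_le, exp_pos|].
intro n. rewrite <- Rpower_pow by lra. unfold Rpower. rewrite <- exp_plus. apply exp_le_mono.
assert (Hn : 0 < INR (n + 1)) by (apply lt_0_INR; lia).
pose proof (ln_le_linear a (INR (n + 1)) Ha Hn) as E.
apply (Rmult_le_compat_l sigma) in E; [|assumption].
assert (E2 : sigma * a <= ln q).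
{ assert (Ea : (sigma + 1) * a = ln q) by (unfold a; field; lra). lra. }
apply (Rmult_le_compat_r (INR (n + 1))) in E2; [|lra].
rewrite plus_INR in *. simpl INR in *. nra.
Qed.

Lemma list_argmax {X : Type} (f : X -> R) (T : list X) s1 : In s1 T ->
  exists s0, In s0 T /\ forall s, In s T -> f s <= f s0.
Proof.
intro Hs1. destruct T as [|t T]; [contradiction|]. clear Hs1.
induction T as [|t' T IH].
- exists t. split; [left; reflexivity|]. intros s [->|[]]; apply Rle_refl.
- destruct IH as [s0 [Hs0 Hmax]]. destruct (Rle_dec (f s0) (f t')) as [Hle|Hlt].
  + exists t'. split; [right; left; reflexivity|].
    intros s [->|[->|Hs]]; [| apply Rle_refl |];
    (apply Rle_trans with (2 := Hle); apply Hmax; simpl; auto).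
  + exists s0. split; [destruct Hs0; simpl; auto|].
    intros s [->|[->|Hs]]; [apply Hmax; simpl; auto|lra|apply Hmax; simpl; auto].
Qed.

(** An entry that fails at one threshold fails at all smaller ones, so finitely many failures can be
    discarded together. This will fix one generator of maximal displacement for a whole sequence of
    scales. *)
Lemma list_pigeonhole {X : Type} (Q : R -> X -> Prop) (T : list X) :
  (forall eps eps' s, eps <= eps' -> Q eps s -> Q eps' s) ->
  (forall eps, 0 < eps -> exists s, In s T /\ Q eps s) ->
  exists s, In s T /\ forall eps, 0 < eps -> Q eps s.
Proof.
intros Hmon. induction T as [|t T IH]; intro HQ.
- destruct (HQ 1) as [s [[] _]]; lra.
- destruct (classic (forall eps, 0 < eps -> Q eps t)) as [Ht|Ht].
  + exists t. split; [left; reflexivity|assumption].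
  + apply not_all_ex_not in Ht. destruct Ht as [eps0 Ht].
    apply imply_to_and in Ht. destruct Ht as [He0 Ht].
    destruct IH as [s [Hs Hall]]; [|exists s; split; [right; assumption|assumption]].
    intros eps He. destruct (HQ (Rmin eps eps0)) as [s [[<-|Hs] HQs]].
    * apply Rmin_pos; assumption.
    * elim Ht. apply (Hmon (Rmin eps eps0)); [apply Rmin_r|assumption].
    * exists s. split; [assumption|]. apply (Hmon (Rmin eps eps0)); [apply Rmin_l|assumption].
Qed.

Lemma max_index (P : nat -> Prop) B :
  P 0%nat -> exists n, P n /\ forall m, (m <= B)%nat -> P m -> (m <= n)%nat.
Proof.
intro P0. induction B as [|B [n [Hn Hm]]].
- exists 0%nat; split; [assumption|lia].
- destruct (classic (P (S B))) as [HS|HS].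
  + exists (S B); split; [assumption|lia].
  + exists n; split; [assumption|]. intros m HmB HP.
    destruct (Nat.eq_dec m (S B)) as [->|]; [contradiction|apply Hm; [lia|assumption]].
Qed.

Lemma fast_subsequence (P : nat -> nat -> Prop) :
  (forall i, exists N, forall n, (N <= n)%nat -> P i n) ->
  exists phi : nat -> nat, forall i j, (i <= j)%nat -> P i (phi j).
Proof.
intro HP. destruct (choice (fun i N => forall n, (N <= n)%nat -> P i n) HP) as [N HN].
(* Summing makes [phi j] at least [N i] for every [i <= j]. *)
pose (phi := fix phi j := match j with O => N O | S j' => (phi j' + N (S j'))%nat end).
exists phi. intros i j Hij. apply HN. induction Hij.
- destruct i; simpl; lia.
- simpl; lia.
Qed.

(** * Semi-inner products and their Hausdorff quotients *)

Section SemiInner.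

Variables (V : Type) (zero : V) (add : V -> V -> V) (scal : R -> V -> V)
  (ip : V -> V -> R).
Hypothesis ip_sym : forall x y, ip x y = ip y x.
Hypothesis ip_zero : forall z, ip zero z = 0.
Hypothesis ip_add : forall x y z, ip (add x y) z = ip x z + ip y z.
Hypothesis ip_scal : forall a x z, ip (scal a x) z = a * ip x z.
Hypothesis ip_pos : forall x, 0 <= ip x x.

Let sub x y := add x (scal (-1) y).

Lemma ip_add_r x y z : ip z (add x y) = ip z x + ip z y.
Proof. rewrite ip_sym, ip_add, (ip_sym x), (ip_sym y); ring. Qed.

Lemma ip_scal_r a x z : ip z (scal a x) = a * ip z x.
Proof. rewrite ip_sym, ip_scal, (ip_sym x); ring. Qed.

Lemma semi_cauchy_schwarz x y : ip x y * ip x y <= ip x x * ip y y.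
Proof.
assert (Hq : forall a c, 0 <= a * a * ip x x + 2 * a * c * ip x y + c * c * ip y y).
{ intros a c. pose proof (ip_pos (add (scal a x) (scal c y))) as Hp.
  rewrite ip_add, !ip_add_r, !ip_scal, !ip_scal_r, (ip_sym y x) in Hp. nra. }
pose proof (ip_pos x); pose proof (ip_pos y).
destruct (Req_dec (ip y y) 0) as [Hy|Hy].
- destruct (Req_dec (ip x y) 0) as [Hxy|Hxy]; [rewrite Hxy, Hy; lra|].
  (* With [ip y y = 0] the form is affine in its second coefficient, and this choice gives it the
     value -1. *)
  pose proof (Hq 1 (- (ip x x + 1) / (2 * ip x y))) as Ht. rewrite Hy in Ht.
  replace (2 * 1 * (- (ip x x + 1) / (2 * ip x y)) * ip x y)
    with (- (ip x x + 1)) in Ht by (field; assumption). lra.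
- pose proof (Hq (ip y y) (- ip x y)) as Ht.
  assert (0 <= ip y y * (ip x x * ip y y - ip x y * ip x y)) as Hp by lra.
  rewrite <- (Rmult_0_r (ip y y)) in Hp. apply Rmult_le_reg_l in Hp; lra.
Qed.

Lemma semi_null_inner x z : ip x x = 0 -> ip x z = 0.
Proof.
intro Hx. pose proof (semi_cauchy_schwarz x z) as Hc. rewrite Hx in Hc.
pose proof (Rle_0_sqr (ip x z)); unfold Rsqr in *. nra.
Qed.

Lemma semi_sub_triangle x y z :
  ip (sub x z) (sub x z) <= 2 * ip (sub x y) (sub x y) + 2 * ip (sub y z) (sub y z).
Proof.
(* Parallelogram law: [x - z] is the sum and [x + z - 2 y] the difference of [x - y] and [y - z]. *)
unfold sub. pose proof (ip_pos (add (add x z) (scal (-2) y))) as Hp.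
repeat rewrite ?ip_add, ?ip_scal, ?ip_add_r, ?ip_scal_r in Hp.
repeat rewrite ?ip_add, ?ip_scal, ?ip_add_r, ?ip_scal_r.
rewrite (ip_sym z x), (ip_sym y x), (ip_sym z y) in *. lra.
Qed.

Hypothesis ip_complete : forall u : nat -> V,
  (forall eps, 0 < eps -> exists N, forall m n, (N <= m)%nat -> (N <= n)%nat ->
     ip (sub (u m) (u n)) (sub (u m) (u n)) < eps) ->
  exists l, forall eps, 0 < eps -> exists N, forall n, (N <= n)%nat ->
     ip (sub (u n) l) (sub (u n) l) < eps.

(** Vectors with the same pairings are to be identified. The representative is a function of [ip x]
    alone, so the quotient by null vectors can be encoded as the subtype of fixed points of
    [canon]. *)
Definition canon (x : V) : V :=
  epsilon (inhabits zero) (fun y => forall z, ip x z = ip y z).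

Lemma ip_canon x z : ip (canon x) z = ip x z.
Proof.
symmetry. revert z. apply (epsilon_spec (inhabits zero) (fun y => forall z, ip x z = ip y z)).
exists x; reflexivity.
Qed.

Lemma canon_ext x y : (forall z, ip x z = ip y z) -> canon x = canon y.
Proof.
intro Hxy. unfold canon. f_equal. apply functional_extensionality; intro t.
apply propositional_extensionality.
split; intros Ht z; rewrite <- Ht; [symmetry|]; apply Hxy.
Qed.

Let Q := {x : V | canon x = x}.
Let rep (q : Q) : V := proj1_sig q.
Let qcls (x : V) : Q := exist _ (canon x) (canon_ext _ _ (ip_canon x)).

Lemma ip_rep_qcls x z : ip (rep (qcls x)) z = ip x z.
Proof. apply ip_canon. Qed.

Lemma ip_rep_qcls_r x z : ip z (rep (qcls x)) = ip z x.
Proof. rewrite ip_sym, ip_rep_qcls; apply ip_sym. Qed.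

Lemma quotient_ext (p q : Q) : (forall z, ip (rep p) z = ip (rep q) z) -> p = q.
Proof.
destruct p as [x Hx], q as [y Hy]; simpl; intro Hxy.
assert (x = y) as -> by (rewrite <- Hx, <- Hy; apply canon_ext, Hxy).
f_equal; apply proof_irrelevance.
Qed.

(** Serves both for ultrapowers and for the quotient by a line. Completeness is required only of the
    semi-inner product, before passing to the quotient. *)
Lemma hilbert_of_semi : exists (K : Hilbert) (cls : V -> K),
  (forall x y, cls (add x y) = hadd (cls x) (cls y)) /\
  (forall a x, cls (scal a x) = hscal a (cls x)) /\
  (forall x y, hinner (cls x) (cls y) = ip x y) /\
  (forall q, exists x, cls x = q).
Proof.
pose (qadd := fun p q : Q => qcls (add (rep p) (rep q))).
pose (qopp := fun p : Q => qcls (scal (-1) (rep p))).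
pose (qscal := fun a (p : Q) => qcls (scal a (rep p))).
pose (qip := fun p q : Q => ip (rep p) (rep q)).
assert (Hdist : forall p q, qip (qadd p (qopp q)) (qadd p (qopp q))
                 = ip (sub (rep p) (rep q)) (sub (rep p) (rep q))).
{ intros p q. unfold qip, qadd, qopp, sub.
  repeat rewrite ?ip_rep_qcls, ?ip_rep_qcls_r, ?ip_add, ?ip_add_r. reflexivity. }
assert (Hsqrt : forall a eps, 0 < eps -> (sqrt a < eps <-> a < eps * eps)).
{ intros a eps He. split; intro Ha.
  - apply Rnot_le_lt; intro Hle. apply sqrt_le_1_alt in Hle.
    rewrite sqrt_square in Hle; lra.
  - destruct (Rle_dec 0 a).
    + rewrite <- (sqrt_square eps) by lra. apply sqrt_lt_1_alt; lra.
    + rewrite sqrt_neg_0; lra. }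
unshelve eexists (Build_Hilbert Q qadd (qcls zero) qopp qscal qip
  _ _ _ _ _ _ _ _ _ _ _ _ _ _), qcls;
  try (intros; apply quotient_ext; intro; unfold qadd, qopp, qscal;
       repeat (rewrite ip_rep_qcls || rewrite ip_add || rewrite ip_scal || rewrite ip_zero);
       ring).
- intros; apply ip_sym.
- intros; unfold qip, qadd; rewrite ip_rep_qcls; apply ip_add.
- intros; unfold qip, qscal; rewrite ip_rep_qcls; apply ip_scal.
- intros; apply ip_pos.
- intros x Hx. apply quotient_ext; intro z. rewrite ip_rep_qcls, ip_zero.
  apply semi_null_inner, Hx.
- intros u Hu. destruct (ip_complete (fun n => rep (u n))) as [l Hl].
  + intros eps He. destruct (Hu (sqrt eps)) as [N HN]; [apply sqrt_lt_R0, He|].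
    exists N; intros m n Hm Hn. rewrite <- Hdist. rewrite <- (sqrt_sqrt eps) by lra.
    apply Hsqrt; [apply sqrt_lt_R0, He|]. apply HN; assumption.
  + exists (qcls l). intros eps He. destruct (Hl (eps * eps)) as [N HN]; [nra|].
    exists N; intros n Hn. apply Hsqrt; [assumption|]. rewrite Hdist.
    unfold sub in *.
    repeat (rewrite ip_rep_qcls || rewrite ip_rep_qcls_r || rewrite ip_add
            || rewrite ip_add_r || rewrite ip_scal || rewrite ip_scal_r).
    specialize (HN n Hn).
    repeat (rewrite ip_add in HN || rewrite ip_add_r in HN
            || rewrite ip_scal in HN || rewrite ip_scal_r in HN). exact HN.
- simpl. repeat split.
  + intros; apply quotient_ext; intro; unfold qadd.
    repeat (rewrite ip_rep_qcls || rewrite ip_add). reflexivity.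
  + intros; apply quotient_ext; intro; unfold qscal.
    repeat (rewrite ip_rep_qcls || rewrite ip_scal). reflexivity.
  + intros; unfold qip. rewrite ip_rep_qcls, ip_rep_qcls_r; reflexivity.
  + intro q; exists (rep q). apply quotient_ext; intro. apply ip_rep_qcls.
Qed.

End SemiInner.

(** * Elementary Hilbert space facts *)

Lemma inner_zero_l {H : Hilbert} (z : H) : hinner hzero z = 0.
Proof. pose proof (h_inner_add H hzero hzero z) as E. rewrite h_add_0 in E; lra. Qed.

Lemma inner_opp_l {H : Hilbert} (x z : H) : hinner (hopp x) z = - hinner x z.
Proof.
pose proof (h_inner_add H x (hopp x) z) as E.
rewrite h_add_opp, inner_zero_l in E; lra.
Qed.

Lemma inner_add_r {H : Hilbert} (x y z : H) : hinner z (hadd x y) = hinner z x + hinner z y.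
Proof. rewrite !(h_inner_sym _ z); apply h_inner_add. Qed.

Lemma inner_scal_r {H : Hilbert} a (x z : H) : hinner z (hscal a x) = a * hinner z x.
Proof. rewrite !(h_inner_sym _ z); apply h_inner_scal. Qed.

Lemma inner_zero_r {H : Hilbert} (z : H) : hinner z hzero = 0.
Proof. rewrite h_inner_sym; apply inner_zero_l. Qed.

Lemma inner_opp_r {H : Hilbert} (x z : H) : hinner z (hopp x) = - hinner z x.
Proof. rewrite !(h_inner_sym _ z); apply inner_opp_l. Qed.

Ltac inner_expand :=
  repeat (rewrite h_inner_add || rewrite inner_add_r || rewrite h_inner_scal
    || rewrite inner_scal_r || rewrite inner_opp_l || rewrite inner_opp_r
    || rewrite inner_zero_l || rewrite inner_zero_r).

Definition hsub {H : Hilbert} (x y : H) : H := hadd x (hopp y).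

Lemma hsub_eq {H : Hilbert} (x y : H) : hsub x y = hzero -> x = y.
Proof.
intro E. unfold hsub in E. rewrite <- (h_add_0 _ y), <- E.
rewrite (h_add_comm _ x), h_add_assoc, h_add_opp, h_add_comm, h_add_0. reflexivity.
Qed.

(** Pairing with an arbitrary vector turns a vector identity into an identity of reals that [ring]
    can decide; [hvec] packages this. *)
Lemma hext {H : Hilbert} (x y : H) : (forall z, hinner x z = hinner y z) -> x = y.
Proof.
intro E. apply hsub_eq, h_inner_def. unfold hsub at 1. inner_expand. rewrite E; ring.
Qed.

Ltac hvec := apply hext; intro; unfold hsub in *; inner_expand.

Lemma hnorm_pos {H : Hilbert} (x : H) : 0 <= hnorm x.
Proof. apply sqrt_pos. Qed.

Lemma hnorm_sqr {H : Hilbert} (x : H) : hnorm x * hnorm x = hinner x x.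
Proof. apply sqrt_sqrt, h_inner_pos. Qed.

Lemma hnorm_zero {H : Hilbert} : hnorm (hzero : H) = 0.
Proof. unfold hnorm; rewrite inner_zero_l; apply sqrt_0. Qed.

Lemma hnorm_eq0 {H : Hilbert} (x : H) : hnorm x = 0 -> x = hzero.
Proof. intro E. apply h_inner_def. rewrite <- hnorm_sqr, E; ring. Qed.

Lemma hnorm_neq0 {H : Hilbert} (x : H) : x <> hzero -> 0 < hnorm x.
Proof.
intro Hx. destruct (hnorm_pos x) as [|E]; [assumption|].
elim Hx; apply hnorm_eq0; auto.
Qed.

Lemma cauchy_schwarz {H : Hilbert} (x y : H) : Rabs (hinner x y) <= hnorm x * hnorm y.
Proof.
pose proof (semi_cauchy_schwarz H hadd hscal hinner (h_inner_sym H) (h_inner_add H)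
  (h_inner_scal H) (h_inner_pos H) x y) as E.
rewrite <- !hnorm_sqr in E. pose proof (hnorm_pos x); pose proof (hnorm_pos y).
apply Rsqr_incr_0_var; [|nra]. rewrite <- Rsqr_abs. unfold Rsqr; nra.
Qed.

Lemma hnorm_le_sqr {H : Hilbert} (x : H) (a : R) :
  0 <= a -> hinner x x <= a * a -> hnorm x <= a.
Proof.
intros Ha Hx. unfold hnorm. rewrite <- (sqrt_square a Ha). apply sqrt_le_1_alt, Hx.
Qed.

Lemma hnorm_triangle {H : Hilbert} (x y : H) : hnorm (hadd x y) <= hnorm x + hnorm y.
Proof.
pose proof (hnorm_pos x); pose proof (hnorm_pos y). apply hnorm_le_sqr; [lra|].
inner_expand. rewrite (h_inner_sym _ y x), <- !hnorm_sqr.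
pose proof (cauchy_schwarz x y). pose proof (Rle_abs (hinner x y)). lra.
Qed.

Lemma hnorm_scal {H : Hilbert} a (x : H) : hnorm (hscal a x) = Rabs a * hnorm x.
Proof.
unfold hnorm. inner_expand. rewrite <- Rmult_assoc, sqrt_mult_alt.
- f_equal. apply sqrt_Rsqr_abs.
- apply Rle_0_sqr.
Qed.

Lemma hnorm_opp {H : Hilbert} (x : H) : hnorm (hopp x) = hnorm x.
Proof. unfold hnorm. inner_expand. f_equal; ring. Qed.

Lemma hnorm_sub_le {H : Hilbert} (x y : H) : hnorm (hsub x y) <= hnorm x + hnorm y.
Proof. unfold hsub. rewrite <- (hnorm_opp y). apply hnorm_triangle. Qed.

Lemma hnorm_sub_sym {H : Hilbert} (x y : H) : hnorm (hsub x y) = hnorm (hsub y x).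
Proof. rewrite <- hnorm_opp. f_equal. hvec; ring. Qed.

Lemma hnorm_le_add_sub {H : Hilbert} (x y : H) : hnorm x <= hnorm y + hnorm (hsub x y).
Proof.
replace x with (hadd y (hsub x y)) at 1 by (hvec; ring). apply hnorm_triangle.
Qed.

Lemma hnorm_lt_sqr {H : Hilbert} (x : H) (eps : R) :
  0 < eps -> hinner x x < eps * eps -> hnorm x < eps.
Proof. rewrite <- hnorm_sqr. pose proof (hnorm_pos x). intros; nra. Qed.

(** * Ultrapowers of Hilbert spaces *)

Record free_ultrafilter (U : (nat -> Prop) -> Prop) : Prop := {
  uf_mono : forall P Q : nat -> Prop, (forall k, P k -> Q k) -> U P -> U Q;
  uf_and : forall P Q, U P -> U Q -> U (fun k => P k /\ Q k);
  uf_proper : ~ U (fun _ => False);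
  uf_dec : forall P, U P \/ U (fun k => ~ P k);
  uf_tail : forall n, U (fun k => (n <= k)%nat)
}.

Lemma free_ultrafilter_exists : exists U, free_ultrafilter U.
Proof.
pose (F := fun P : nat -> Prop => exists n, forall k, (n <= k)%nat -> P k).
destruct (@filter.ultraFilterLemma nat F) as [U [HU HFU]].
{ split.
  - intros [n Hn]. exact (Hn n (le_n n)).
  - split.
    + exists 0%nat; intros; exact I.
    + intros P Q [n Hn] [m Hm]. exists (Nat.max n m); intros k Hk.
      split; [apply Hn|apply Hm]; lia.
    + intros P Q HPQ [n Hn]. exists n; intros k Hk; apply HPQ, Hn, Hk. }
destruct HU as [[HU0 [HUT HUI HUS]] HUmax].
assert (Hmono : forall P Q : nat -> Prop, (forall k, P k -> Q k) -> U P -> U Q)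
  by (intros P Q HPQ; apply HUS; exact HPQ).
assert (Hand : forall P Q, U P -> U Q -> U (fun k => P k /\ Q k))
  by (intros P Q HP HQ; exact (HUI P Q HP HQ)).
assert (Hprop : ~ U (fun _ => False)) by exact HU0.
exists U; split; [exact Hmono|exact Hand|exact Hprop| |].
- intro P. destruct (classic (U (fun k => ~ P k))) as [|Hn]; [right; assumption|left].
  (* If the complement of [P] is not in [U], the filter generated by [U] and [P] is proper, hence
     equal to [U] by maximality. *)
  pose (G := fun X : nat -> Prop => exists Y, U Y /\ forall k, Y k -> P k -> X k).
  rewrite <- (HUmax G).
  + exists (fun _ => True). split; [exact HUT|auto].
  + split.
    * intros [Y [HY HYP]]. apply Hn. apply (Hmono Y); [|assumption].
      intros k Hk HPk. exact (HYP k Hk HPk).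
    * split.
      -- exists (fun _ => True); split; [exact HUT|intros; exact I].
      -- intros X X' [Y [HY HX]] [Y' [HY' HX']].
         exists (fun k => Y k /\ Y' k); split; [apply Hand; assumption|].
         intros k [] HPk; split; auto.
      -- intros X X' HXX [Y [HY HX]]. exists Y; split; [assumption|].
         intros k HYk HPk; apply HXX; auto.
  + intros X HX. exists X; auto.
- intro n. apply HFU. exists n; auto.
Qed.

(** Bundling the bound guarantees that termwise inner products have an ultralimit. *)
Definition bseq (H : Hilbert) := {x : nat -> H | exists M, forall k, hnorm (x k) <= M}.

Definition bseq_get {H : Hilbert} (x : bseq H) : nat -> H := proj1_sig x.
Coercion bseq_get : bseq >-> Funclass.

Lemma bseq_bounded {H : Hilbert} (x : bseq H) : exists M, 0 <= M /\ forall k, hnorm (x k) <= M.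
Proof.
destruct x as [x [M HM]]; exists M; split; [|exact HM].
apply Rle_trans with (1 := hnorm_pos (x 0%nat)), HM.
Qed.

Lemma bconst_bounded {H : Hilbert} (v : H) : exists M, forall k : nat, hnorm ((fun _ => v) k) <= M.
Proof. exists (hnorm v); intro; apply Rle_refl. Qed.

Definition bconst {H : Hilbert} (v : H) : bseq H := exist _ (fun _ => v) (bconst_bounded v).

Lemma badd_bounded {H : Hilbert} (x y : bseq H) : exists M, forall k, hnorm (hadd (x k) (y k)) <= M.
Proof.
destruct (bseq_bounded x) as [M [_ HM]], (bseq_bounded y) as [M' [_ HM']].
exists (M + M'); intro k. pose proof (hnorm_triangle (x k) (y k)).
specialize (HM k); specialize (HM' k); lra.
Qed.

Definition badd {H : Hilbert} (x y : bseq H) : bseq H :=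
  exist _ (fun k => hadd (x k) (y k)) (badd_bounded x y).

Lemma bscal_bounded {H : Hilbert} a (x : bseq H) : exists M, forall k, hnorm (hscal a (x k)) <= M.
Proof.
destruct (bseq_bounded x) as [M [_ HM]]. exists (Rabs a * M); intro k.
rewrite hnorm_scal. apply Rmult_le_compat_l; [apply Rabs_pos|apply HM].
Qed.

Definition bscal {H : Hilbert} a (x : bseq H) : bseq H :=
  exist _ (fun k => hscal a (x k)) (bscal_bounded a x).

Section Ultralimit.

Variable U : (nat -> Prop) -> Prop.
Hypothesis HU : free_ultrafilter U.

Lemma uf_all (P : nat -> Prop) : (forall k, P k) -> U P.
Proof. intro HP. apply (uf_mono U HU (fun k => (0 <= k)%nat)); auto. apply uf_tail, HU. Qed.

Lemma uf_ex (P : nat -> Prop) : U P -> exists k, P k.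
Proof.
intro HP. apply NNPP; intro Hn. apply (uf_proper U HU).
apply (uf_mono U HU P); [|assumption]. intros k Hk; apply Hn; exists k; assumption.
Qed.

Lemma uf_forall_le (P : nat -> nat -> Prop) i :
  (forall a, (a <= i)%nat -> U (P a)) -> U (fun k => forall a, (a <= i)%nat -> P a k).
Proof.
induction i as [|i IH]; intro HP.
- apply (uf_mono U HU (P 0%nat)); [|apply HP; lia].
  intros k Hk a Ha. replace a with 0%nat by lia; assumption.
- apply (uf_mono U HU (fun k => (forall a, (a <= i)%nat -> P a k) /\ P (S i) k)).
  + intros k [H1 H2] a Ha. destruct (Nat.eq_dec a (S i)) as [->|]; [assumption|apply H1; lia].
  + apply uf_and; [assumption|apply IH; intros; apply HP; lia|apply HP; lia].
Qed.

Definition is_ulim (a : nat -> R) (l : R) : Prop :=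
  forall eps, 0 < eps -> U (fun k => Rabs (a k - l) < eps).

Lemma ulim_exists a M : (forall k, Rabs (a k) <= M) -> exists l, is_ulim a l.
Proof.
intro Ha.
assert (Hb : forall k, - M <= a k <= M)
  by (intro k; specialize (Ha k); unfold Rabs in Ha; destruct Rcase_abs; lra).
(* The ultralimit is the supremum of the levels [t] with [t <= a k] for almost every [k]. *)
destruct (completeness (fun t => U (fun k => t <= a k))) as [l [Hl1 Hl2]].
- exists (M + 1). intros t Ht. apply uf_ex in Ht. destruct Ht as [k Hk].
  specialize (Hb k); lra.
- exists (- M). apply uf_all; intro k; apply Hb.
- exists l. intros eps He.
  assert (H1 : U (fun k => l - eps < a k)).
  { destruct (uf_dec U HU (fun k => l - eps < a k)) as [|Hn]; [assumption|exfalso].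
    assert (l <= l - eps); [|lra]. apply Hl2. intros t Ht.
    destruct (uf_ex _ (uf_and U HU _ _ Ht Hn)) as [k [Hk1 Hk2]]. lra. }
  assert (H2 : U (fun k => a k < l + eps)).
  { destruct (uf_dec U HU (fun k => a k < l + eps)) as [|Hn]; [assumption|exfalso].
    assert (l + eps <= l); [|lra]. apply Hl1. apply (uf_mono U HU _ _ (fun k Hk => Rnot_lt_le _ _ Hk) Hn). }
  apply (uf_mono U HU _ _ (fun k Hk => Rabs_def1 _ _ (proj1 Hk) (proj2 Hk))).
  apply (uf_mono U HU (fun k => l - eps < a k /\ a k < l + eps)).
  + intros k []; split; lra.
  + apply uf_and; assumption.
Qed.

Lemma ulim_le a b la lb :
  U (fun k => a k <= b k) -> is_ulim a la -> is_ulim b lb -> la <= lb.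
Proof.
intros Hab Ha Hb. apply Rnot_lt_le; intro Hl.
assert (He : 0 < (la - lb) / 2) by lra.
destruct (uf_ex _ (uf_and U HU _ _ Hab (uf_and U HU _ _ (Ha _ He) (Hb _ He)))) as [k [H1 [H2 H3]]].
apply Rabs_def2 in H2; apply Rabs_def2 in H3; lra.
Qed.

Lemma ulim_unique a l l' : is_ulim a l -> is_ulim a l' -> l = l'.
Proof.
intros Hl Hl'. apply Rle_antisym; apply (ulim_le a a); try assumption;
apply uf_all; intro; lra.
Qed.

Lemma ulim_add a b la lb :
  is_ulim a la -> is_ulim b lb -> is_ulim (fun k => a k + b k) (la + lb).
Proof.
intros Ha Hb eps He. assert (He2 : 0 < eps / 2) by lra.
apply (uf_mono U HU (fun k => Rabs (a k - la) < eps / 2 /\ Rabs (b k - lb) < eps / 2)).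
- intros k [H1 H2]. apply Rabs_def2 in H1; apply Rabs_def2 in H2; apply Rabs_def1; lra.
- apply uf_and; auto.
Qed.

Lemma ulim_scal c a la : is_ulim a la -> is_ulim (fun k => c * a k) (c * la).
Proof.
intros Ha eps He. pose proof (Rabs_pos c) as Hc.
apply (uf_mono U HU (fun k => Rabs (a k - la) < eps / (Rabs c + 1))).
- intros k Hk. rewrite <- Rmult_minus_distr_l, Rabs_mult.
  apply (Rmult_lt_compat_l (Rabs c + 1)) in Hk; [|lra].
  replace ((Rabs c + 1) * (eps / (Rabs c + 1))) with eps in Hk by (field; lra).
  pose proof (Rabs_pos (a k - la)). lra.
- apply Ha. apply Rdiv_lt_0_compat; lra.
Qed.

Lemma ulim_ext a b l : (forall k, a k = b k) -> is_ulim a l -> is_ulim b l.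
Proof.
intros Hab Ha eps He. apply (uf_mono U HU _ _ (fun k Hk => eq_ind _ (fun t => Rabs (t - l) < eps) Hk _ (Hab k))).
apply Ha, He.
Qed.

Lemma ulim_const c : is_ulim (fun _ => c) c.
Proof. intros eps He. apply uf_all; intro. rewrite Rminus_diag, Rabs_R0. assumption. Qed.

Lemma ulim_of_cv a l :
  (forall eps, 0 < eps -> exists N, forall k, (N <= k)%nat -> Rabs (a k - l) < eps) ->
  is_ulim a l.
Proof.
intros Ha eps He. destruct (Ha eps He) as [N HN].
apply (uf_mono U HU _ _ HN). apply uf_tail, HU.
Qed.

Context {H : Hilbert}.

Lemma bip_ulim (x y : bseq H) : exists l, is_ulim (fun k => hinner (x k) (y k)) l.
Proof.
destruct (bseq_bounded x) as [M [HM0 HM]], (bseq_bounded y) as [M' [HM0' HM']].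
apply (ulim_exists _ (M * M')); intro k. apply Rle_trans with (1 := cauchy_schwarz _ _).
apply Rmult_le_compat; auto using hnorm_pos.
Qed.

Definition bip (x y : bseq H) : R :=
  epsilon (inhabits 0) (is_ulim (fun k => hinner (x k) (y k))).

Lemma bip_spec (x y : bseq H) : is_ulim (fun k => hinner (x k) (y k)) (bip x y).
Proof. unfold bip. apply epsilon_spec, bip_ulim. Qed.

Lemma bip_unique (x y : bseq H) l : is_ulim (fun k => hinner (x k) (y k)) l -> bip x y = l.
Proof. apply ulim_unique, bip_spec. Qed.

Lemma bip_sym (x y : bseq H) : bip x y = bip y x.
Proof.
apply bip_unique. apply (ulim_ext (fun k => hinner (y k) (x k))).
- intro; apply h_inner_sym.
- apply bip_spec.
Qed.

Lemma bip_zero (z : bseq H) : bip (bconst hzero) z = 0.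
Proof.
apply bip_unique. apply (ulim_ext (fun _ => 0)).
- intro; symmetry; apply inner_zero_l.
- apply ulim_const.
Qed.

Lemma bip_add (x y z : bseq H) : bip (badd x y) z = bip x z + bip y z.
Proof.
apply bip_unique. apply (ulim_ext (fun k => hinner (x k) (z k) + hinner (y k) (z k))).
- intro; symmetry; apply h_inner_add.
- apply ulim_add; apply bip_spec.
Qed.

Lemma bip_scal a (x z : bseq H) : bip (bscal a x) z = a * bip x z.
Proof.
apply bip_unique. apply (ulim_ext (fun k => a * hinner (x k) (z k))).
- intro; symmetry; apply h_inner_scal.
- apply ulim_scal; apply bip_spec.
Qed.

Lemma bip_pos (x : bseq H) : 0 <= bip x x.
Proof.
apply (ulim_le (fun _ => 0) (fun k => hinner (x k) (x k))).
- apply uf_all; intro; apply h_inner_pos.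
- apply ulim_const.
- apply bip_spec.
Qed.

Let bsub (x y : bseq H) := badd x (bscal (-1) y).

(* Saturation: the limit follows, at the index k, the farthest term X_n (n <= k)
   for which the estimates between X_0, ..., X_n already hold at k. *)
Lemma bseq_complete (u : nat -> bseq H) :
  (forall eps, 0 < eps -> exists N, forall m n, (N <= m)%nat -> (N <= n)%nat ->
     bip (bsub (u m) (u n)) (bsub (u m) (u n)) < eps) ->
  exists l, forall eps, 0 < eps -> exists N, forall n, (N <= n)%nat ->
     bip (bsub (u n) l) (bsub (u n) l) < eps.
Proof.
intro Hu. pose (e := fun i : nat => / (INR i + 1)).
assert (He : forall i, 0 < e i)
  by (intro i; apply Rinv_0_lt_compat; pose proof (pos_INR i); lra).
destruct (fast_subsequence (fun i p => forall m n, (p <= m)%nat -> (p <= n)%nat ->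
  bip (bsub (u m) (u n)) (bsub (u m) (u n)) < e i)) as [phi Hphi].
{ intro i. destruct (Hu (e i) (He i)) as [N HN]. exists N; intros; apply HN; lia. }
pose (X := fun i => u (phi i)).
assert (HX : forall i j, (i <= j)%nat -> bip (bsub (X i) (X j)) (bsub (X i) (X j)) < e i).
{ intros i j Hij. destruct (Nat.le_gt_cases (phi i) (phi j)).
  - apply (Hphi i i); lia.
  - apply (Hphi i j); lia. }
pose (good := fun k i => forall a, (a <= i)%nat -> forall b, (b <= i)%nat -> (a <= b)%nat ->
   hinner (bsub (X a) (X b) k) (bsub (X a) (X b) k) <= e a).
destruct (choice (fun k n => good k n /\ forall m, (m <= k)%nat -> good k m -> (m <= n)%nat))
  as [n Hn].
{ intro k. apply max_index. intros a Ha b Hb _.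
  replace a with 0%nat by lia; replace b with 0%nat by lia.
  simpl. inner_expand. pose proof (He 0%nat). lra. }
assert (HgU : forall i, U (fun k => good k i)).
{ intro i. apply (uf_forall_le (fun a k => forall b, (b <= i)%nat -> (a <= b)%nat ->
    hinner (bsub (X a) (X b) k) (bsub (X a) (X b) k) <= e a)).
  intros a Ha.
  apply (uf_forall_le (fun b k => (a <= b)%nat ->
    hinner (bsub (X a) (X b) k) (bsub (X a) (X b) k) <= e a)).
  intros b Hb. destruct (Nat.le_gt_cases a b) as [Hab|Hab].
  - pose proof (HX a b Hab) as Hlt.
    refine (uf_mono U HU _ _ _ (bip_spec (bsub (X a) (X b)) (bsub (X a) (X b))
      (e a - bip (bsub (X a) (X b)) (bsub (X a) (X b))) _)); [|lra].
    intros k Hk _. apply Rabs_def2 in Hk; lra.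
  - apply uf_all; intro; lia. }
assert (HYb : exists M, forall k, hnorm (X (n k) k) <= M).
{ destruct (bseq_bounded (X 0%nat)) as [M [HM0 HM]].
  exists (M + 1); intro k. destruct (Hn k) as [Hg _].
  specialize (Hg 0%nat (Nat.le_0_l _) (n k) (le_n _) (Nat.le_0_l _)).
  specialize (HM k).
  assert (Hd : hnorm (hsub (X (n k) k) (X 0%nat k)) <= 1).
  { rewrite hnorm_sub_sym. apply hnorm_le_sqr; [lra|].
    replace (1 * 1) with (e 0%nat) by (unfold e; simpl; field).
    unfold hsub. revert Hg. simpl. inner_expand. lra. }
  pose proof (hnorm_le_add_sub (X (n k) k) (X 0%nat k)). lra. }
pose (Y := exist _ (fun k => X (n k) k) HYb : bseq H).
(* For almost every [k] the index [i] is good at [k], so [i <= n k] by maximality, and the estimate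
   between [X i] and [X (n k)] holds at [k]. *)
assert (HXY : forall i, bip (bsub (X i) Y) (bsub (X i) Y) <= e i).
{ intro i. refine (ulim_le _ (fun _ => e i) _ _ _ (bip_spec (bsub (X i) Y) (bsub (X i) Y)) (ulim_const _)).
  apply (uf_mono U HU (fun k => good k i /\ (i <= k)%nat)).
  - intros k [Hg Hk]. destruct (Hn k) as [Hg1 Hg2]. specialize (Hg2 i Hk Hg).
    exact (Hg1 i Hg2 (n k) (le_n _) Hg2).
  - apply uf_and; [assumption|apply HgU|apply uf_tail, HU]. }
exists Y. intros eps Heps.
destruct (archimed_cor1 (eps / 4)) as [i [Hi Hi0]]; [lra|].
assert (Hei : e i < eps / 4).
{ unfold e. apply Rlt_trans with (2 := Hi). apply Rinv_lt_contravar.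
  - apply lt_0_INR in Hi0. nra.
  - lra. }
exists (phi i). intros m Hm.
pose proof (semi_sub_triangle (bseq H) badd bscal bip bip_sym bip_add bip_scal bip_pos
  (u m) (X i) Y) as Ht.
pose proof (Hphi i i (le_n i) m (phi i) Hm (le_n _)) as H1. specialize (HXY i).
unfold bsub, X in *. lra.
Qed.

Lemma ultrapower : exists (K : Hilbert) (cls : bseq H -> K),
  (forall x y, cls (badd x y) = hadd (cls x) (cls y)) /\
  (forall a x, cls (bscal a x) = hscal a (cls x)) /\
  (forall x y, hinner (cls x) (cls y) = bip x y) /\
  (forall q, exists x, cls x = q).
Proof.
exact (hilbert_of_semi (bseq H) (bconst hzero) badd bscal bip bip_sym bip_zero
  bip_add bip_scal bip_pos bseq_complete).
Qed.

End Ultralimit.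

(** * Means *)

(** With [F := fun s => f (mul x s)] this is the left side of [harmonic] up to conversion. *)
Definition hmean {X : Type} {H : Hilbert} (S : list X) (F : X -> H) : H :=
  hscal (/ INR (length S)) (hsum (map F S)).

Section Mean.

Context {X : Type} {H : Hilbert}.
Implicit Types (S : list X) (F : X -> H).

Lemma hmean_ext S F F' : (forall s, In s S -> F s = F' s) -> hmean S F = hmean S F'.
Proof. intro E. unfold hmean. do 2 f_equal. apply map_ext_in, E. Qed.

Lemma hsum_add S F F' :
  hsum (map (fun s => hadd (F s) (F' s)) S) = hadd (hsum (map F S)) (hsum (map F' S)).
Proof. induction S as [|s S IH]; simpl; [hvec; ring|rewrite IH; hvec; ring]. Qed.

Lemma hsum_scal S a F : hsum (map (fun s => hscal a (F s)) S) = hscal a (hsum (map F S)).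
Proof. induction S as [|s S IH]; simpl; [hvec; ring|rewrite IH; hvec; ring]. Qed.

Lemma hmean_add S F F' : hmean S (fun s => hadd (F s) (F' s)) = hadd (hmean S F) (hmean S F').
Proof. unfold hmean. rewrite hsum_add. hvec; ring. Qed.

Lemma hmean_scal S a F : hmean S (fun s => hscal a (F s)) = hscal a (hmean S F).
Proof. unfold hmean. rewrite hsum_scal. hvec; ring. Qed.

Lemma INR_length_neq0 S : S <> nil -> 0 < INR (length S).
Proof. destruct S; [congruence|intros _; apply lt_0_INR; simpl; lia]. Qed.

Lemma hmean_const S (v : H) : S <> nil -> hmean S (fun _ => v) = v.
Proof.
intro HS. unfold hmean.
assert (E : hsum (map (fun _ => v) S) = hscal (INR (length S)) v).
{ clear. induction S as [|s S IH]; [simpl; hvec; ring|].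
  cbn [map hsum fold_right length]. rewrite S_INR. unfold hsum in IH. rewrite IH. hvec; ring. }
rewrite E. pose proof (INR_length_neq0 S HS). hvec. field. lra.
Qed.

Lemma linear_zero (T : H -> H) : is_linear T -> T hzero = hzero.
Proof.
intros [_ HT]. replace (hzero : H) with (hscal 0 (hzero : H)) at 1 by (hvec; ring).
rewrite HT. hvec; ring.
Qed.

Lemma linear_sub (T : H -> H) x y : is_linear T -> T (hsub x y) = hsub (T x) (T y).
Proof.
intros [Ha Hs]. replace (hsub x y) with (hadd x (hscal (-1) y)) by (hvec; ring).
rewrite Ha, Hs. hvec; ring.
Qed.

Lemma hmean_map {K : Hilbert} S F (T : H -> K) :
  (forall x y, T (hadd x y) = hadd (T x) (T y)) ->
  (forall a x, T (hscal a x) = hscal a (T x)) ->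
  T (hmean S F) = hmean S (fun s => T (F s)).
Proof.
intros Ha Hs. unfold hmean. rewrite Hs. f_equal. induction S as [|s S IH]; simpl.
- replace (hzero : H) with (hscal 0 (hzero : H)) by (hvec; ring). rewrite Hs. hvec; ring.
- rewrite Ha, IH; reflexivity.
Qed.

Lemma hmean_sub_const S F v :
  S <> nil -> hmean S (fun s => hsub (F s) v) = hsub (hmean S F) v.
Proof.
intro HS. unfold hsub. rewrite hmean_add, hmean_const by assumption. reflexivity.
Qed.

Lemma hmean_norm_le S F M : S <> nil -> (forall s, In s S -> hnorm (F s) <= M) -> hnorm (hmean S F) <= M.
Proof.
intros HS HF. unfold hmean. rewrite hnorm_scal.
assert (E : hnorm (hsum (map F S)) <= INR (length S) * M).
{ clear HS. induction S as [|s S IH].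
  - simpl. rewrite hnorm_zero. lra.
  - cbn [map hsum fold_right length]. rewrite S_INR.
    apply Rle_trans with (1 := hnorm_triangle _ _).
    assert (hnorm (F s) <= M) by (apply HF; left; reflexivity).
    assert (hnorm (hsum (map F S)) <= INR (length S) * M)
      by (apply IH; intros; apply HF; right; assumption).
    unfold hsum in *. lra. }
pose proof (INR_length_neq0 S HS) as HN. pose proof (Rinv_0_lt_compat _ HN) as HI.
rewrite Rabs_pos_eq by lra. apply (Rmult_le_compat_l _ _ _ (Rlt_le _ _ HI)) in E.
rewrite <- Rmult_assoc, Rinv_l in E; lra.
Qed.

Lemma hsum_permutation (l l' : list H) : Permutation l l' -> hsum l = hsum l'.
Proof.
induction 1; simpl; [reflexivity|congruence| |congruence].
rewrite !h_add_assoc. f_equal. apply h_add_comm.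
Qed.

End Mean.

Lemma bmean_exists {X : Type} {H K : Hilbert} (cls : bseq H -> K) (F : X -> bseq H) (T : list X) :
  (forall x y, cls (badd x y) = hadd (cls x) (cls y)) ->
  (forall a x, cls (bscal a x) = hscal a (cls x)) ->
  exists y : bseq H, (forall k, y k = hmean T (fun s => F s k)) /\
    cls y = hmean T (fun s => cls (F s)).
Proof.
intros cadd cscal.
assert (exists y : bseq H, (forall k, y k = hsum (map (fun s => F s k) T)) /\
    cls y = hsum (map (fun s => cls (F s)) T)) as [y [Hy Hcy]].
{ induction T as [|s T [y [Hy Hcy]]].
  - exists (bscal 0 (bconst hzero)). split; [intro k; simpl; hvec; ring|].
    rewrite cscal. simpl. hvec; ring.
  - exists (badd (F s) y). split; [intro k; simpl; rewrite Hy; reflexivity|].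
    rewrite cadd, Hcy. reflexivity. }
exists (bscal (/ INR (length T)) y). split.
- intro k. simpl. rewrite Hy. reflexivity.
- rewrite cscal, Hcy. reflexivity.
Qed.

Lemma bseq_ext {H : Hilbert} (x y : bseq H) : (forall k, x k = y k) -> x = y.
Proof.
destruct x as [x Hx], y as [y Hy]; simpl; intro E.
assert (x = y) as -> by (apply functional_extensionality, E).
f_equal; apply proof_irrelevance.
Qed.

(** * Fixed points and approximate resolvents of an affine operator *)

Section AffineOperator.

Variables (H : Hilbert) (L : H -> H) (c : R) (bb : H).
Hypothesis HL : is_linear L.
Hypothesis Hc0 : 0 <= c.
Hypothesis Hc : opnorm_le L c.

Lemma affine_displacement_sub (v v' : H) :
  hnorm (hsub (hadd (L v) bb) v) <=
  hnorm (hsub (hadd (L v') bb) v') + (c + 1) * hnorm (hsub v v').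
Proof.
replace (hsub (hadd (L v) bb) v) with
  (hadd (hsub (hadd (L v') bb) v') (hsub (L (hsub v v')) (hsub v v')))
  by (rewrite (linear_sub L) by exact HL; hvec; ring).
apply Rle_trans with (1 := hnorm_triangle _ _).
pose proof (hnorm_sub_le (L (hsub v v')) (hsub v v')). pose proof (Hc (hsub v v')). lra.
Qed.

(** Convexity of the set of nearly fixed vectors, in the one instance that the parallelogram law
    uses. *)
Lemma affine_displacement_midpoint (v v' : H) eps :
  hnorm (hsub (hadd (L v) bb) v) <= eps -> hnorm (hsub (hadd (L v') bb) v') <= eps ->
  let m := hscal (1 / 2) (hadd v v') in hnorm (hsub (hadd (L m) bb) m) <= eps.
Proof.
intros Hv Hv' m. destruct HL as [Ha Hs].
replace (hsub (hadd (L m) bb) m) with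
  (hadd (hscal (1 / 2) (hsub (hadd (L v) bb) v)) (hscal (1 / 2) (hsub (hadd (L v') bb) v')))
  by (unfold m; rewrite Hs, Ha; hvec; field).
apply Rle_trans with (1 := hnorm_triangle _ _).
rewrite !hnorm_scal, (Rabs_pos_eq (1 / 2)) by lra. lra.
Qed.

(* The nearly fixed vectors form a decreasing sequence of closed convex sets;
   their elements of nearly minimal norm are Cauchy by the parallelogram law. *)
Lemma fixed_point_of_bounded_almost_fixed M :
  (forall eps, 0 < eps -> exists v, hnorm v <= M /\ hnorm (hsub (hadd (L v) bb) v) <= eps) ->
  exists v, hadd (L v) bb = v.
Proof.
intro Haf. pose (e := fun n : nat => / (INR n + 1)).
assert (He : forall n, 0 < e n)
  by (intro n; apply Rinv_0_lt_compat; pose proof (pos_INR n); lra).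
assert (Hemon : forall n m, (n <= m)%nat -> e m <= e n).
{ intros n m Hnm. apply Rinv_le_contravar; [pose proof (pos_INR n); lra|].
  apply le_INR in Hnm; lra. }
assert (Hesmall : forall eps, 0 < eps -> exists N, e N < eps).
{ intros eps Heps. destruct (archimed_cor1 eps Heps) as [N [HN HN0]]. exists N.
  apply Rlt_trans with (2 := HN). apply Rinv_lt_contravar; [|lra].
  apply lt_0_INR in HN0. nra. }
pose (C := fun n v => hnorm (hsub (hadd (L v) bb) v) <= e n).
assert (HCmon : forall n m v, (n <= m)%nat -> C m v -> C n v)
  by (intros n m v Hnm Hv; apply Rle_trans with (1 := Hv), Hemon, Hnm).
(* [l] is the limit of the infima of the squared norm on the sets [C n], which increase with [n] and
   stay below [M * M]. *)
destruct (completeness (fun t => exists n, forall v, C n v -> t <= hinner v v)) as [l [Hl1 Hl2]].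
- exists (M * M). intros t [n Hn]. destruct (Haf (e n) (He n)) as [v [Hv1 Hv2]].
  specialize (Hn v Hv2). rewrite <- hnorm_sqr in Hn. pose proof (hnorm_pos v). nra.
- exists 0, 0%nat. intros; apply h_inner_pos.
- assert (Hlow : forall j, exists n, (j <= n)%nat /\ forall v, C n v -> l - e j <= hinner v v).
  { intro j. apply NNPP; intro Hn. assert (l <= l - e j); [|specialize (He j); lra].
    apply Hl2. intros t [n Ht]. apply Rnot_lt_le; intro Hlt. apply Hn.
    exists (Nat.max n j); split; [lia|]. intros v Hv.
    assert (t <= hinner v v) by (apply Ht, (HCmon n (Nat.max n j)); [lia|assumption]). lra. }
  destruct (choice _ Hlow) as [n Hn].
  assert (Hup : forall j, exists v, C (n j) v /\ hinner v v <= l + e j).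
  { intro j. apply NNPP; intro Hno. assert (l + e j <= l); [|specialize (He j); lra].
    apply Hl1. exists (n j). intros v Hv. apply Rnot_lt_le; intro Hlt. apply Hno.
    exists v; split; [assumption|lra]. }
  destruct (choice _ Hup) as [u Hu].
  (* Parallelogram law: twice the sum of the two squared norms is at most [4 * (l + e N)], and four
     times that of the midpoint is at least [4 * (l - e N)]. *)
  assert (Hclose : forall N i j, (N <= i)%nat -> (N <= j)%nat ->
            hinner (hsub (u i) (u j)) (hsub (u i) (u j)) <= 8 * e N).
  { intros N i j Hi Hj.
    assert (Hmid : l - e N <= hinner (hscal (1 / 2) (hadd (u i) (u j))) (hscal (1 / 2) (hadd (u i) (u j)))).
    { destruct (Nat.le_gt_cases (n i) (n j)) as [Hij|Hij].
      - apply Rle_trans with (l - e i); [specialize (Hemon N i Hi); lra|].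
        apply (proj2 (Hn i)). apply affine_displacement_midpoint; [apply Hu|].
        apply (HCmon (n i) (n j)); [assumption|apply Hu].
      - apply Rle_trans with (l - e j); [specialize (Hemon N j Hj); lra|].
        apply (proj2 (Hn j)). apply affine_displacement_midpoint; [|apply Hu].
        apply (HCmon (n j) (n i)); [lia|apply Hu]. }
    destruct (Hu i) as [_ Hui], (Hu j) as [_ Huj].
    pose proof (Hemon N i Hi); pose proof (Hemon N j Hj).
    revert Hmid. unfold hsub. inner_expand. rewrite (h_inner_sym _ (u j) (u i)). lra. }
  destruct (h_complete H u) as [x Hx].
  + intros eps Heps. destruct (Hesmall (eps * eps / 8)) as [N HN]; [nra|].
    exists N; intros i j Hi Hj. apply hnorm_lt_sqr; [assumption|].
    specialize (Hclose N i j Hi Hj). unfold hsub in Hclose. lra.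
  + exists x. apply hsub_eq, hnorm_eq0. apply Rle_antisym; [|apply hnorm_pos].
    apply le_epsilon. intros eps Heps.
    destruct (Hesmall (eps / 2)) as [N1 HN1]; [lra|].
    destruct (Hx (eps / (2 * (c + 1)))) as [N2 HN2]; [apply Rdiv_lt_0_compat; lra|].
    pose (j := Nat.max N1 N2).
    specialize (HN2 j ltac:(unfold j; lia)). change (hnorm (hsub (u j) x) < eps / (2 * (c + 1))) in HN2.
    assert (HCj : C N1 (u j)).
    { apply (HCmon N1 (n j)); [|apply Hu]. pose proof (proj1 (Hn j)). unfold j in *. lia. }
    unfold C in HCj. apply Rle_trans with (1 := affine_displacement_sub x (u j)).
    rewrite hnorm_sub_sym in HN2. apply (Rmult_lt_compat_l (c + 1)) in HN2; [|lra].
    replace ((c + 1) * (eps / (2 * (c + 1)))) with (eps / 2) in HN2 by (field; lra). lra.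
Qed.

Hypothesis Hgrowth : forall q, 1 < q -> exists K, forall n v,
  hnorm (Nat.iter n L v) <= K * q ^ n * hnorm v.

(** Truncated Neumann series: iterating [v |-> (L v + bb) / mu] from 0 leaves a residual of norm
    [mu^(-n) * hnorm (L^n bb)], small by subexponential growth. An approximate solution is enough
    later, so no limit is taken. *)
Lemma approximate_resolvent mu eta :
  1 < mu -> 0 < eta -> exists v, hnorm (hsub (hscal mu v) (hadd (L v) bb)) <= eta.
Proof.
intros Hmu Heta.
assert (Hz : forall n, exists v, hsub (hadd (L v) bb) (hscal mu v) = hscal ((/ mu) ^ n) (Nat.iter n L bb)).
{ induction n as [|n [v Hv]].
  - exists hzero. rewrite (linear_zero L HL). simpl. hvec; ring.
  - exists (hscal (/ mu) (hadd (L v) bb)). destruct HL as [Ha Hs].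
    rewrite Hs. simpl Nat.iter. apply (f_equal L) in Hv.
    rewrite Hs in Hv. rewrite <- tech_pow_Rmult.
    assert (Hv' : hscal ((/ mu) ^ n) (L (Nat.iter n L bb)) = hsub (L (hadd (L v) bb)) (hscal mu (L v)))
      by (rewrite <- Hv, (linear_sub L), Hs by exact HL; reflexivity).
    apply hext; intro t. apply (f_equal (fun x => hinner x t)) in Hv'. revert Hv'.
    unfold hsub. inner_expand. intro Hv'. rewrite Rmult_assoc, Hv'. field. lra. }
(* A growth rate strictly between 1 and [mu]; its quotient by [mu] is the ratio [q < 1]. *)
destruct (Hgrowth ((1 + mu) / 2)) as [K HK]; [lra|].
pose (q := (1 + mu) / 2 * / mu).
assert (Hq : Rabs q < 1).
{ pose proof (Rinv_0_lt_compat mu). unfold q. rewrite Rabs_pos_eq by nra.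
  apply (Rmult_lt_reg_r mu); [lra|]. rewrite Rmult_assoc, Rinv_l; lra. }
destruct (pow_lt_1_zero q Hq (eta / (Rabs K * hnorm bb + 1))) as [n Hn].
{ apply Rdiv_lt_0_compat; [assumption|]. pose proof (Rabs_pos K); pose proof (hnorm_pos bb). nra. }
specialize (Hn n (le_n n)). destruct (Hz n) as [v Hv]. exists v.
rewrite hnorm_sub_sym, Hv, hnorm_scal. specialize (HK n bb).
assert (0 < / mu) by (apply Rinv_0_lt_compat; lra).
rewrite Rabs_pos_eq by (apply pow_le; lra).
apply (Rmult_le_compat_l ((/ mu) ^ n)) in HK; [|apply pow_le; lra].
apply Rle_trans with (1 := HK).
assert (Hqn : 0 <= q ^ n) by (apply pow_le; unfold q; nra).
rewrite Rabs_pos_eq in Hn by assumption.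
replace ((/ mu) ^ n * (K * ((1 + mu) / 2) ^ n * hnorm bb)) with (K * (q ^ n * hnorm bb))
  by (unfold q; rewrite Rpow_mult_distr; ring).
pose proof (Rabs_pos K); pose proof (hnorm_pos bb); pose proof (Rle_abs K).
apply Rle_trans with (Rabs K * (q ^ n * hnorm bb)).
- apply Rmult_le_compat_r; [nra|assumption].
- assert (HD : 0 < Rabs K * hnorm bb + 1) by nra.
  apply (Rmult_lt_compat_r _ _ _ HD) in Hn.
  replace (eta / (Rabs K * hnorm bb + 1) * (Rabs K * hnorm bb + 1)) with eta in Hn by (field; lra).
  nra.
Qed.

(* The solutions v of mu v = L v + bb satisfy, with w = L v + bb - v = (mu - 1) v,
   the identity L w - w = (mu - 1) (w - bb); the last term is negligible as mu -> 1
   unless v stays bounded. *)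
Lemma fixed_point_or_almost_harmonic :
  (exists v, hadd (L v) bb = v) \/
  (forall eps, 0 < eps -> exists v, let w := hsub (hadd (L v) bb) v in
     w <> hzero /\ hnorm (hsub (L w) w) <= eps * hnorm w).
Proof.
destruct (classic (exists M, forall eps, 0 < eps ->
  exists v, hnorm v <= M /\ hnorm (hsub (hadd (L v) bb) v) <= eps)) as [[M HM]|Hno].
{ left. apply fixed_point_of_bounded_almost_fixed with M, HM. }
right. intros eps Heps. pose (D := hnorm bb). assert (HD : 0 <= D) by apply hnorm_pos.
(* Chosen so that [hnorm w >= t * (M - 1)] implies [t * (D + 1) <= eps / 2 * hnorm w], whatever the
   size of [t]. *)
pose (M := 1 + 2 * (D + 1) / eps).
assert (HM : eps / 2 * (M - 1) = D + 1) by (unfold M; field; lra).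
assert (HM1 : 1 < M) by (assert (0 < 2 * (D + 1) / eps) by (apply Rdiv_lt_0_compat; lra); unfold M; lra).
assert (exists eps0, 0 < eps0 /\ forall v, hnorm v <= M -> eps0 < hnorm (hsub (hadd (L v) bb) v))
  as [eps0 [He0 Hfar]].
{ apply NNPP; intro Hn. apply Hno. exists M. intros eps1 He1. apply NNPP; intro Hn1. apply Hn.
  exists eps1; split; [assumption|]. intros v Hv. apply Rnot_le_lt; intro Hle. apply Hn1.
  exists v; auto. }
(* [t] stands for mu - 1. The first bound absorbs [t * hnorm w]; the second forces [hnorm v > M],
   since otherwise the displacement of [v] would be at most [t * (M + 1) <= eps0]. *)
pose (t := Rmin (eps / 2) (eps0 / (M + 1))).
assert (Ht : 0 < t) by (apply Rmin_pos; [lra|apply Rdiv_lt_0_compat; lra]).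
assert (Ht1 : t <= eps / 2) by apply Rmin_l.
assert (Ht2 : t * (M + 1) <= eps0).
{ assert (t <= eps0 / (M + 1)) as E by apply Rmin_r.
  apply (Rmult_le_compat_r (M + 1)) in E; [|lra].
  replace (eps0 / (M + 1) * (M + 1)) with eps0 in E by (field; lra). exact E. }
(* The tolerance on the residual [r] makes both [r] and [r - L r] of norm at most [t]. *)
destruct (approximate_resolvent (1 + t) (t / (c + 1))) as [v Hv]; [lra|apply Rdiv_lt_0_compat; lra|].
pose (r := hsub (hscal (1 + t) v) (hadd (L v) bb)). fold r in Hv.
assert (Hr : (c + 1) * hnorm r <= t).
{ apply (Rmult_le_compat_l (c + 1)) in Hv; [|lra].
  replace ((c + 1) * (t / (c + 1))) with t in Hv by (field; lra). exact Hv. }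
pose proof (hnorm_pos r) as Hr0.
assert (Hr1 : hnorm r <= t) by nra.
exists v. intro w.
assert (Hw : w = hsub (hscal t v) r) by (unfold w, r; hvec; ring).
assert (HvM : M < hnorm v).
{ apply Rnot_le_lt; intro Hle. specialize (Hfar v Hle). fold w in Hfar. rewrite Hw in Hfar.
  pose proof (hnorm_sub_le (hscal t v) r) as E. rewrite hnorm_scal, Rabs_pos_eq in E by lra. nra. }
assert (Hwlow : t * (hnorm v - 1) <= hnorm w).
{ pose proof (hnorm_le_add_sub (hscal t v) w) as E. rewrite hnorm_scal, Rabs_pos_eq in E by lra.
  replace (hsub (hscal t v) w) with r in E by (rewrite Hw; hvec; ring). lra. }
assert (HLw : hsub (L w) w = hadd (hscal t (hsub w bb)) (hsub r (L r))).
{ replace (L w) with (hsub (hscal t (L v)) (L r))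
    by (rewrite Hw, (linear_sub L), (proj2 HL) by exact HL; reflexivity).
  replace (hsub w bb) with (hsub (L v) v) by (unfold w; hvec; ring).
  rewrite Hw. clearbody r. clear. hvec; ring. }
split.
- intro E. rewrite E, hnorm_zero in Hwlow. nra.
- rewrite HLw. apply Rle_trans with (1 := hnorm_triangle _ _).
  rewrite hnorm_scal, Rabs_pos_eq by lra.
  pose proof (hnorm_sub_le w bb) as E1. fold D in E1.
  pose proof (hnorm_sub_le r (L r)). pose proof (Hc r).
  apply (Rmult_le_compat_l t) in E1; [|lra].
  pose proof (hnorm_pos w).
  assert (t * hnorm w <= eps / 2 * hnorm w) by (apply Rmult_le_compat_r; assumption).
  assert (t * (D + 1) <= eps / 2 * hnorm w).
  { rewrite <- HM. apply Rle_trans with (eps / 2 * (t * (hnorm v - 1))).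
    - replace (t * (eps / 2 * (M - 1))) with (eps / 2 * (t * (M - 1))) by ring.
      apply Rmult_le_compat_l; [lra|]. apply Rmult_le_compat_l; lra.
    - apply Rmult_le_compat_l; lra. }
  lra.
Qed.

End AffineOperator.

(** * Affine actions and their limits *)

Lemma bounded_linear_nonneg {H : Hilbert} (T : H -> H) :
  bounded_linear T -> exists K, 0 <= K /\ opnorm_le T K.
Proof.
intros [_ [K HK]]. exists (Rabs K); split; [apply Rabs_pos|]. intro v.
apply Rle_trans with (1 := HK v). apply Rmult_le_compat_r; [apply hnorm_pos|apply Rle_abs].
Qed.

Section Action.

Variables (G : Type) (mul : G -> G -> G) (inv : G -> G) (e : G) (S : list G).

Definition has_harmonic_map (C sigma : R) : Prop :=
  exists (H' : Hilbert) (rho' : G -> H' -> H') (A' : G -> H' -> H') (b' : G -> H'),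
    affine_action mul e H' rho' A' b' /\
    linear_growth_bound mul inv e S H' A' C sigma /\
    exists f : G -> H',
      nonconstant f /\ harmonic mul S f /\ equivariant mul rho' f.

Hypothesis HG : is_group G mul inv e.
Hypothesis HS : S <> nil.

(** Affine maps commute with means, so the mean value property at [e] propagates along the orbit. *)
Lemma harmonic_orbit (H : Hilbert) rho A b C sigma (v : H) :
  affine_action mul e H rho A b -> linear_growth_bound mul inv e S H A C sigma ->
  hmean S (fun s => rho s v) = v -> (exists g, rho g v <> v) ->
  has_harmonic_map C sigma.
Proof.
intros Hact Hbd Hv [g Hg]. exists H, rho, A, b.
split; [exact Hact|split; [exact Hbd|]]. destruct Hact as [Hlin [Hrho [He Hmul]]].
exists (fun g => rho g v). split; [|split].
- exists g, e. rewrite He. exact Hg.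
- intro x. change (hmean S (fun s => rho (mul x s) v) = rho x v).
  rewrite (hmean_ext S _ (fun s => hadd (A x (rho s v)) (b x)))
    by (intros; rewrite Hmul, Hrho; reflexivity).
  rewrite hmean_add, hmean_const by assumption.
  rewrite <- (hmean_map S (fun s => rho s v) (A x)) by apply Hlin. rewrite Hv, Hrho; reflexivity.
- intros x y. apply Hmul.
Qed.

Section Linear.

Variables (H : Hilbert) (rho A : G -> H -> H) (b : G -> H).
Hypothesis Hact : affine_action mul e H rho A b.

Lemma action_linear g : is_linear (A g).
Proof. apply Hact. Qed.

Lemma cocycle_one : b e = hzero.
Proof.
destruct Hact as [Hlin [Hrho [He _]]]. specialize (He hzero).
rewrite Hrho, (linear_zero (A e)) in He by apply Hlin. rewrite <- He. hvec; ring.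
Qed.

Lemma linear_part_one v : A e v = v.
Proof.
destruct Hact as [Hlin [Hrho [He _]]]. specialize (He v).
rewrite Hrho, cocycle_one, h_add_0 in He. exact He.
Qed.

Lemma cocycle_mul g h : b (mul g h) = hadd (A g (b h)) (b g).
Proof.
destruct Hact as [Hlin [Hrho [He Hmul]]]. specialize (Hmul g h hzero).
rewrite !Hrho, !(linear_zero (A _)) in Hmul by apply Hlin.
replace (b h) with (hadd hzero (b h)) by (hvec; ring). rewrite <- Hmul. hvec; ring.
Qed.

Lemma linear_part_mul g h v : A (mul g h) v = A g (A h v).
Proof.
pose proof (cocycle_mul g h) as Hc. destruct Hact as [Hlin [Hrho [He Hmul]]].
specialize (Hmul g h v). rewrite !Hrho, Hc in Hmul.
rewrite (proj1 (proj1 (Hlin g))) in Hmul.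
apply hext; intro z. apply (f_equal (fun t => hinner t z)) in Hmul. revert Hmul.
inner_expand. lra.
Qed.

Lemma linear_action : affine_action mul e H A A (fun _ => hzero).
Proof.
split; [|split; [|split]].
- apply Hact.
- intros; hvec; ring.
- apply linear_part_one.
- apply linear_part_mul.
Qed.

(** The displacements of [v] form the cocycle of the action with origin moved to [v], whose linear
    part is still [A]. *)
Lemma displacement_mul g h v :
  hsub (rho (mul g h) v) v = hadd (A g (hsub (rho h v) v)) (hsub (rho g v) v).
Proof.
rewrite (linear_sub (A g)) by apply action_linear.
destruct Hact as [Hlin [Hrho [He Hmul]]]. rewrite Hmul, !(Hrho g). hvec; ring.
Qed.

(** The constant depends on [g] and [M] but not on [v] or [r], which keeps rescaled displacements
    bounded along a sequence of base points. *)
Lemma displacement_bounded M :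
  (forall g, exists w, Forall (fun s => In s S) w /\ word_prod mul e w = g) ->
  forall g, exists M', forall v r,
    (forall s, In s S -> hnorm (hsub (rho s v) v) <= M * r) ->
    hnorm (hsub (rho g v) v) <= M' * r.
Proof.
intros Hgen g. destruct (Hgen g) as [w [Hw <-]]. clear Hgen.
induction Hw as [|s w Hs Hw [M' IH]]; simpl.
- exists 0; intros v r _. rewrite (proj1 (proj2 (proj2 Hact))).
  unfold hsub; rewrite h_add_opp, hnorm_zero; lra.
- destruct (bounded_linear_nonneg (A s)) as [K [HK0 HK]]; [apply Hact|].
  exists (K * M' + M); intros v r Hv. rewrite displacement_mul.
  apply Rle_trans with (1 := hnorm_triangle _ _).
  specialize (HK (hsub (rho (word_prod mul e w) v) v)).
  specialize (IH v r Hv). apply (Rmult_le_compat_l K) in IH; [|assumption].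
  specialize (Hv s Hs). unfold word_prod in *. lra.
Qed.

(** [TA] and [tb] act on representatives. The norm hypothesis on [TA] does double duty: on the
    kernel of [cls] it makes [A'] well defined, and it carries the growth bound to [K] with
    unchanged constants. *)
Lemma action_descends (V : Type) (add : V -> V -> V) (scal : R -> V -> V) (K : Hilbert)
  (cls : V -> K) (TA : G -> V -> V) (tb : G -> V) :
  (forall x y, cls (add x y) = hadd (cls x) (cls y)) ->
  (forall a x, cls (scal a x) = hscal a (cls x)) ->
  (forall q, exists x, cls x = q) ->
  (forall g x y, cls (TA g (add x y)) = hadd (cls (TA g x)) (cls (TA g y))) ->
  (forall g a x, cls (TA g (scal a x)) = hscal a (cls (TA g x))) ->
  (forall x, cls (TA e x) = cls x) ->
  (forall g h x, cls (TA (mul g h) x) = cls (TA g (TA h x))) ->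
  cls (tb e) = hzero ->
  (forall g h, cls (tb (mul g h)) = hadd (cls (TA g (tb h))) (cls (tb g))) ->
  (forall g M, 0 <= M -> opnorm_le (A g) M ->
     forall x, hnorm (cls (TA g x)) <= M * hnorm (cls x)) ->
  exists (A' : G -> K -> K) (b' : G -> K),
    affine_action mul e K (fun g v => hadd (A' g v) (b' g)) A' b' /\
    (forall C sigma, 0 < C -> linear_growth_bound mul inv e S H A C sigma ->
       linear_growth_bound mul inv e S K A' C sigma) /\
    (forall g x, A' g (cls x) = cls (TA g x)) /\
    (forall g, b' g = cls (tb g)).
Proof.
intros cadd cscal csurj Tadd Tscal Te Tmul be bmul Tbd.
destruct (choice (fun q x => cls x = q) csurj) as [rep Hrep].
pose (A' := fun g q => cls (TA g (rep q))).
assert (HA' : forall g x, A' g (cls x) = cls (TA g x)).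
{ intros g x. unfold A'. apply hsub_eq, hnorm_eq0.
  destruct (bounded_linear_nonneg (A g)) as [M [HM0 HM]]; [apply Hact|].
  replace (hsub _ _) with (cls (TA g (add (rep (cls x)) (scal (-1) x)))).
  - pose proof (Tbd g M HM0 HM (add (rep (cls x)) (scal (-1) x))) as Hle.
    rewrite cadd, cscal, Hrep in Hle.
    replace (hadd (cls x) (hscal (-1) (cls x))) with (hzero : K) in Hle by (hvec; ring).
    rewrite hnorm_zero in Hle. pose proof (hnorm_pos (cls (TA g (add (rep (cls x)) (scal (-1) x))))).
    lra.
  - rewrite Tadd, Tscal. hvec; ring. }
assert (Hbd : forall g M, 0 <= M -> opnorm_le (A g) M -> opnorm_le (A' g) M).
{ intros g M HM0 HM q. destruct (csurj q) as [x <-]. rewrite HA'. apply Tbd; assumption. }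
exists A', (fun g => cls (tb g)). split; [|split; [|split]].
- split; [|split; [|split]].
  + intro g. split; [split|].
    * intros p q. destruct (csurj p) as [x <-], (csurj q) as [y <-].
      rewrite <- cadd, !HA'. apply Tadd.
    * intros a p. destruct (csurj p) as [x <-]. rewrite <- cscal, !HA'. apply Tscal.
    * destruct (bounded_linear_nonneg (A g)) as [M [HM0 HM]]; [apply Hact|].
      exists M; apply Hbd; assumption.
  + reflexivity.
  + intro p. destruct (csurj p) as [x <-]. cbv beta. rewrite HA', Te, be. apply h_add_0.
  + intros g h p. destruct (csurj p) as [x <-].
    cbv beta. rewrite !HA', Tmul, bmul, <- (cadd (TA h x) (tb h)), !HA', Tadd. apply h_add_assoc.
- intros C sigma HC Hg g Hge. apply Hbd; [|apply Hg, Hge].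
  apply Rmult_le_pos; [lra|apply Rlt_le, exp_pos].
- exact HA'.
- reflexivity.
Qed.

End Linear.

(** * Ultralimits of rescaled affine actions *)

Section LimitAction.

Variables (H : Hilbert) (rho A : G -> H -> H) (b : G -> H).
Hypothesis Hact : affine_action mul e H rho A b.
Hypothesis Hgen : forall g, exists w, Forall (fun s => In s S) w /\ word_prod mul e w = g.

Lemma blinear_bounded g (x : bseq H) : exists M, forall k, hnorm (A g (x k)) <= M.
Proof.
destruct (bounded_linear_nonneg (A g)) as [K [HK0 HK]]; [apply Hact|].
destruct (bseq_bounded x) as [M [HM0 HM]]. exists (K * M); intro k.
apply Rle_trans with (1 := HK _). apply Rmult_le_compat_l; auto.
Qed.

(** The action is based at [v k], dilated by [/ r k] and passed to the ultralimit. The ultrafilter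
    stays hidden: later arguments see [cls] only through unit sequences, asymptotically equal
    sequences, displacements and termwise means. *)
Lemma rescaled_limit (v : nat -> H) (r : nat -> R) (M : R) :
  (forall k, 0 < r k) ->
  (forall k s, In s S -> hnorm (hsub (rho s (v k)) (v k)) <= M * r k) ->
  exists (K : Hilbert) (A' : G -> K -> K) (b' : G -> K) (cls : bseq H -> K),
    affine_action mul e K (fun g q => hadd (A' g q) (b' g)) A' b' /\
    (forall C sigma, 0 < C -> linear_growth_bound mul inv e S H A C sigma ->
       linear_growth_bound mul inv e S K A' C sigma) /\
    (forall x : bseq H, (forall k, hnorm (x k) = 1) -> cls x <> hzero) /\
    (forall x y : bseq H, (forall eps, 0 < eps -> exists N, forall k, (N <= k)%nat ->
       hnorm (hsub (x k) (y k)) < eps) -> cls x = cls y) /\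
    cls (bconst hzero) = hzero /\
    (forall g, exists y : bseq H, (forall k, y k = hscal (/ r k) (hsub (rho g (v k)) (v k))) /\
       b' g = cls y) /\
    (exists y : bseq H, (forall k, y k = hscal (/ r k) (hsub (hmean S (fun s => rho s (v k))) (v k))) /\
       hmean S b' = cls y) /\
    (forall x : bseq H, exists y : bseq H, (forall k, y k = hmean S (fun s => A s (x k))) /\
       hmean S (fun s => A' s (cls x)) = cls y).
Proof.
intros Hr HM. destruct free_ultrafilter_exists as [U HU].
destruct (ultrapower U HU (H := H)) as [K [cls [cadd [cscal [cip csurj]]]]].
pose (TA := fun g (x : bseq H) => exist _ (fun k => A g (x k)) (blinear_bounded g x) : bseq H).
assert (Hb : forall g, exists M', forall k, hnorm (hscal (/ r k) (hsub (rho g (v k)) (v k))) <= M').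
{ intro g. destruct (displacement_bounded H rho A b Hact M Hgen g) as [M' HM'].
  exists M'; intro k. specialize (HM' (v k) (r k) (HM k)). specialize (Hr k).
  pose proof (Rinv_0_lt_compat _ Hr) as Hi.
  rewrite hnorm_scal, Rabs_pos_eq by lra. apply (Rmult_le_compat_l (/ r k)) in HM'; [|lra].
  replace (/ r k * (M' * r k)) with M' in HM' by (field; lra). exact HM'. }
pose (tb := fun g => exist _ (fun k => hscal (/ r k) (hsub (rho g (v k)) (v k))) (Hb g) : bseq H).
assert (cnorm : forall (x : bseq H) a, 0 <= a -> (forall k, hnorm (x k) = a) -> hnorm (cls x) = a).
{ intros x a Ha Hx. unfold hnorm. rewrite cip, <- (sqrt_square a Ha). f_equal.
  apply bip_unique; [assumption|]. apply (ulim_ext U HU (fun _ => a * a)).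
  - intro k. rewrite <- hnorm_sqr, Hx. reflexivity.
  - apply ulim_const, HU. }
assert (czero : forall x : bseq H, (forall k, x k = hzero) -> cls x = hzero).
{ intros x Hx. apply hnorm_eq0, cnorm; [lra|]. intro k; rewrite Hx; apply hnorm_zero. }
destruct (action_descends H rho A b Hact (bseq H) badd bscal K cls TA tb
  cadd cscal csurj) as [A' [b' [Hact' [Hgr [HA' Hb']]]]].
- intros g x y. rewrite <- cadd. f_equal. apply bseq_ext; intro k. simpl.
  apply (action_linear H rho A b Hact g).
- intros g a x. rewrite <- cscal. f_equal. apply bseq_ext; intro k. simpl.
  apply (action_linear H rho A b Hact g).
- intro x. f_equal. apply bseq_ext; intro k. apply (linear_part_one _ _ _ _ Hact).
- intros g h x. f_equal. apply bseq_ext; intro k. apply (linear_part_mul _ _ _ _ Hact).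
- apply czero. intro k. simpl. rewrite (proj1 (proj2 (proj2 Hact))). hvec; ring.
- intros g h. rewrite <- cadd. f_equal. apply bseq_ext; intro k. simpl.
  rewrite (displacement_mul _ _ _ _ Hact).
  rewrite (proj2 (action_linear H rho A b Hact g)). hvec; ring.
- intros g M' HM0 HM' x. apply hnorm_le_sqr.
  + apply Rmult_le_pos; [assumption|apply hnorm_pos].
  + replace (M' * hnorm (cls x) * (M' * hnorm (cls x))) with (M' * M' * (hnorm (cls x) * hnorm (cls x))) by ring.
    rewrite hnorm_sqr, !cip.
    apply (ulim_le U HU (fun k => hinner (TA g x k) (TA g x k)) (fun k => M' * M' * hinner (x k) (x k))).
    * apply (uf_all U HU); intro k. simpl. rewrite <- !hnorm_sqr. specialize (HM' (x k)).
      pose proof (hnorm_pos (A g (x k))); pose proof (hnorm_pos (x k)).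
      replace (M' * M' * (hnorm (x k) * hnorm (x k))) with (M' * hnorm (x k) * (M' * hnorm (x k))) by ring.
      apply Rmult_le_compat; assumption.
    * apply bip_spec, HU.
    * apply ulim_scal; [assumption|]. apply bip_spec, HU.
- exists K, A', b', cls. repeat split; try exact Hgr; try apply Hact'.
  + intros x Hx E. apply (f_equal hnorm) in E. rewrite (cnorm x 1), hnorm_zero in E; [lra|lra|assumption].
  + intros x y Hxy. apply hsub_eq.
    replace (hsub (cls x) (cls y)) with (cls (badd x (bscal (-1) y)))
      by (rewrite cadd, cscal; hvec; ring).
    apply h_inner_def. rewrite cip. apply bip_unique; [assumption|]. apply ulim_of_cv; [assumption|].
    intros eps He. destruct (Hxy (sqrt eps)) as [N HN]; [apply sqrt_lt_R0, He|].
    exists N; intros k Hk. specialize (HN k Hk).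
    replace (badd x (bscal (-1) y) k) with (hsub (x k) (y k)) by (simpl; hvec; ring).
    rewrite <- hnorm_sqr, Rminus_0_r. pose proof (hnorm_pos (hsub (x k) (y k))).
    rewrite Rabs_pos_eq by nra. rewrite <- (sqrt_sqrt eps) by lra.
    apply Rmult_le_0_lt_compat; assumption.
  + apply czero; reflexivity.
  + intro g. exists (tb g). split; [reflexivity|apply Hb'].
  + destruct (bmean_exists cls tb S cadd cscal) as [y [Hy Hcy]]. exists y. split.
    * intro k. rewrite Hy. simpl. rewrite hmean_scal, hmean_sub_const by assumption. reflexivity.
    * rewrite Hcy. apply hmean_ext. intros; apply Hb'.
  + intro x. destruct (bmean_exists cls (fun s => TA s x) S cadd cscal) as [y [Hy Hcy]].
    exists y. split; [exact Hy|]. rewrite Hcy. apply hmean_ext. intros; apply HA'.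
Qed.

End LimitAction.

(** The form is the inner product of the components orthogonal to [u], so the quotient by the line
    of [u] is a copy of its orthogonal complement. *)
Lemma orthogonal_quotient (H : Hilbert) (u : H) :
  hinner u u = 1 ->
  exists (K : Hilbert) (cls : H -> K),
    (forall x y, cls (hadd x y) = hadd (cls x) (cls y)) /\
    (forall a x, cls (hscal a x) = hscal a (cls x)) /\
    (forall x y, hinner (cls x) (cls y) = hinner x y - hinner x u * hinner y u) /\
    (forall q, exists x, cls x = q).
Proof.
intro Hu. pose (p := fun x => hsub x (hscal (hinner x u) u)).
apply (hilbert_of_semi H hzero hadd hscal (fun x y => hinner x y - hinner x u * hinner y u)).
- intros; rewrite h_inner_sym; ring.
- intros; rewrite !inner_zero_l; ring.
- intros; rewrite !h_inner_add; ring.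
- intros; rewrite !h_inner_scal; ring.
- intro x. replace (hinner x x - hinner x u * hinner x u) with (hinner (p x) (p x)).
  + apply h_inner_pos.
  + unfold p, hsub. inner_expand. rewrite (h_inner_sym _ u x), Hu. ring.
(* The projections converge in [H], and their limit [l] serves: dropping the component along [u] can
   only shorten [p (z n) - l]. *)
- intros z Hz. destruct (h_complete H (fun n => p (z n))) as [l Hl].
  + intros eps He. destruct (Hz (eps * eps)) as [N HN]; [nra|].
    exists N; intros m n Hm Hn. apply hnorm_lt_sqr; [assumption|].
    apply Rle_lt_trans with (2 := HN m n Hm Hn). apply Req_le.
    unfold p, hsub. inner_expand.
    rewrite (h_inner_sym _ u (z m)), (h_inner_sym _ u (z n)), (h_inner_sym _ (z n) (z m)), Hu. ring.
  + exists l. intros eps He. destruct (Hl (sqrt eps)) as [N HN]; [apply sqrt_lt_R0, He|].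
    exists N; intros n Hn. specialize (HN n Hn). apply sqrt_lt_0_alt in HN.
    apply Rle_lt_trans with (2 := HN).
    unfold p, hsub. inner_expand.
    rewrite (h_inner_sym _ u (z n)), (h_inner_sym _ u l), (h_inner_sym _ l (z n)), Hu.
    pose proof (Rle_0_sqr (hinner l u)). unfold Rsqr in *. lra.
Qed.

(* Modulo the invariant vector w = hmean S b the orbit of 0 is harmonic; were it constant,
   all b g would be multiples of w, hence b (inv s) = - b s and w = 0 by symmetry of S. *)
Lemma harmonic_modulo_invariant (H : Hilbert) rho A b C sigma :
  affine_action mul e H rho A b -> 0 < C -> linear_growth_bound mul inv e S H A C sigma ->
  NoDup S -> (forall s, In s S -> In (inv s) S) ->
  hmean S b <> hzero -> (forall g, A g (hmean S b) = hmean S b) ->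
  has_harmonic_map C sigma.
Proof.
intros Hact HC Hbd Hnd Hsym Hw HAw. set (w := hmean S b) in *.
pose proof (hnorm_neq0 w Hw) as Hw0.
pose (u := hscal (/ hnorm w) w).
assert (Hu : hinner u u = 1).
{ unfold u. inner_expand. rewrite <- hnorm_sqr. field. lra. }
assert (Huw : w = hscal (hnorm w) u) by (unfold u; hvec; field; lra).
assert (HAu : forall g, A g u = u).
{ intro g. unfold u. rewrite (proj2 (action_linear _ _ _ _ Hact g)), HAw. reflexivity. }
destruct (orthogonal_quotient H u Hu) as [K [cls [cadd [cscal [cip csurj]]]]].
assert (cu : cls u = hzero).
{ apply h_inner_def. rewrite cip, Hu. ring. }
assert (cker : forall x, cls x = hzero -> forall g, A g x = x).
{ intros x Hx g. replace x with (hscal (hinner x u) u).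
  - rewrite (proj2 (action_linear _ _ _ _ Hact g)), HAu. reflexivity.
  - symmetry. apply hsub_eq, h_inner_def. apply (f_equal (fun q => hinner q q)) in Hx.
    rewrite cip, inner_zero_l in Hx.
    unfold hsub. inner_expand. rewrite (h_inner_sym _ u x), Hu. lra. }
destruct (action_descends H rho A b Hact H hadd hscal K cls A b cadd cscal csurj)
  as [A' [b' [Hact' [Hgr [HA' Hb']]]]].
- intros g x y. rewrite (proj1 (action_linear _ _ _ _ Hact g)). apply cadd.
- intros g a x. rewrite (proj2 (action_linear _ _ _ _ Hact g)). apply cscal.
- intro x. f_equal. apply (linear_part_one _ _ _ _ Hact).
- intros g h x. f_equal. apply (linear_part_mul _ _ _ _ Hact).
- rewrite (cocycle_one _ _ _ _ Hact).
  replace (hzero : H) with (hscal 0 u) by (hvec; ring). rewrite cscal, cu. hvec; ring.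
- intros g h. rewrite (cocycle_mul _ _ _ _ Hact). apply cadd.
(* [A g] fixes [u] but need not preserve its orthogonal complement. Since [x] and its projection [p]
   have images of the same class and [hnorm p = hnorm (cls x)], the bound for [A g] at [p]
   suffices. *)
- intros g M HM0 HM x. pose (p := hsub x (hscal (hinner x u) u)).
  assert (Hp : forall g', cls (A g' x) = cls (A g' p)).
  { intro g'. unfold p, hsub. replace (hopp (hscal (hinner x u) u)) with (hscal (- hinner x u) u) by (hvec; ring).
    rewrite (proj1 (action_linear _ _ _ _ Hact g')), (proj2 (action_linear _ _ _ _ Hact g')), HAu.
    rewrite cadd, cscal, cu. hvec; ring. }
  assert (Hpn : hnorm p = hnorm (cls x)).
  { unfold hnorm, p, hsub. rewrite cip. f_equal. inner_expand. rewrite (h_inner_sym _ u x), Hu. ring. }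
  rewrite Hp, <- Hpn. apply Rle_trans with (2 := HM p).
  apply hnorm_le_sqr; [apply hnorm_pos|]. rewrite hnorm_sqr, cip.
  pose proof (Rle_0_sqr (hinner (A g p) u)). unfold Rsqr in *. lra.
- apply (harmonic_orbit K _ A' b' C sigma hzero Hact'); [apply Hgr; assumption| |].
  + assert (E : hmean S b' = hzero).
    { rewrite (hmean_ext S b' (fun s => cls (b s))) by (intros; apply Hb').
      rewrite <- hmean_map by assumption. fold w. rewrite Huw, cscal, cu. hvec; ring. }
    transitivity (hmean S b'); [|exact E]. apply hmean_ext. intros s _.
    rewrite (linear_zero (A' s)) by apply Hact'. hvec; ring.
  + apply NNPP; intro Hno. apply Hw.
    assert (Hb0 : forall g, cls (b g) = hzero).
    { intro g. apply NNPP; intro Hg. apply Hno. exists g. rewrite <- Hb' in Hg.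
      rewrite (linear_zero (A' g)) by apply Hact'. intro E. apply Hg. rewrite <- E. hvec; ring. }
    assert (Hinv : forall g, b (inv g) = hscal (-1) (b g)).
    { intro g. pose proof (cocycle_mul _ _ _ _ Hact (inv g) g) as E.
      rewrite (grp_invl _ _ _ _ HG), (cocycle_one _ _ _ _ Hact), cker in E by apply Hb0.
      apply hext; intro z. apply (f_equal (fun t => hinner t z)) in E. revert E. inner_expand. lra. }
    assert (Hinvol : forall g, inv (inv g) = g).
    { intro g. rewrite <- (grp_idr _ _ _ _ HG (inv (inv g))), <- (grp_invl _ _ _ _ HG g).
      rewrite (grp_assoc _ _ _ _ HG), (grp_invl _ _ _ _ HG). apply (grp_idl _ _ _ _ HG). }
    assert (Hperm : Permutation (map inv S) S).
    { apply NoDup_Permutation; [|exact Hnd|].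
      - apply FinFun.Injective_map_NoDup; [|exact Hnd].
        intros g h E. rewrite <- (Hinvol g), E. apply Hinvol.
      - intro g. rewrite in_map_iff. split.
        + intros [h [<- Hh]]. apply Hsym, Hh.
        + intro Hg. exists (inv g). split; [apply Hinvol|apply Hsym, Hg]. }
    assert (Hsum : hsum (map b S) = hscal (-1) (hsum (map b S))).
    { rewrite <- hsum_scal.
      rewrite (map_ext (fun s => hscal (-1) (b s)) (fun s => b (inv s)))
        by (intro; symmetry; apply Hinv).
      rewrite <- (map_map inv b).
      symmetry. apply hsum_permutation, Permutation_map, Hperm. }
    assert (E : hsum (map b S) = hzero).
    { apply hext; intro z. apply (f_equal (fun t => hinner t z)) in Hsum. revert Hsum. inner_expand. lra. }
    unfold w, hmean. rewrite E. hvec; ring.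
Qed.

(** * Growth of the iterated averages *)

Lemma conj_length_word_le w :
  Forall (fun s => In s S) w -> (conj_length mul inv e S (word_prod mul e w) <= length w)%nat.
Proof.
intro Hw. apply Nat.le_trans with (word_length mul e S (word_prod mul e w)).
- apply nat_inf_le. exists e. f_equal.
  rewrite (grp_idl _ _ _ _ HG), <- (grp_idr _ _ _ _ HG (word_prod mul e w)) at 1.
  rewrite <- (grp_assoc _ _ _ _ HG), (grp_idl _ _ _ _ HG).
  rewrite <- (grp_idl _ _ _ _ HG (inv e)), (grp_invr _ _ _ _ HG). apply (grp_idr _ _ _ _ HG).
- apply nat_inf_le. exists w; auto.
Qed.

Lemma word_prod_rcons w s : word_prod mul e (w ++ s :: nil) = mul (word_prod mul e w) s.
Proof.
induction w as [|t w IH]; simpl.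
- rewrite (grp_idl _ _ _ _ HG). apply (grp_idr _ _ _ _ HG).
- unfold word_prod in *. rewrite IH. apply (grp_assoc _ _ _ _ HG).
Qed.

(** The iterate is a mean of [A g v] over words of length [n], so it is bounded by the worst word,
    which is polynomial in [n]. *)
Lemma averages_subexponential (H : Hilbert) rho A b C sigma :
  affine_action mul e H rho A b -> 0 < C -> 0 <= sigma ->
  linear_growth_bound mul inv e S H A C sigma ->
  forall q, 1 < q -> exists K, forall n v,
    hnorm (Nat.iter n (fun v => hmean S (fun s => A s v)) v) <= K * q ^ n * hnorm v.
Proof.
intros Hact HC Hs Hbd q Hq. set (L := fun v => hmean S (fun s => A s v)).
(* The summand 1 accounts for words that evaluate to [e], on which [Hbd] is silent. *)
pose (beta := fun n => 1 + C * Rpower (INR (n + 1)) sigma).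
assert (Hword : forall w v, Forall (fun s => In s S) w ->
  hnorm (A (word_prod mul e w) v) <= beta (length w) * hnorm v).
{ intros w v Hw. pose proof (hnorm_pos v).
  assert (0 < Rpower (INR (length w + 1)) sigma) by apply exp_pos.
  destruct (classic (word_prod mul e w = e)) as [E|E].
  - rewrite E, (linear_part_one _ _ _ _ Hact). unfold beta.
    assert (0 <= C * Rpower (INR (length w + 1)) sigma * hnorm v)
      by (apply Rmult_le_pos; [nra|assumption]). lra.
  - apply Rle_trans with (1 := Hbd _ E v). apply Rmult_le_compat_r; [assumption|].
    pose proof (Rpower_INR_le _ _ sigma Hs (conj_length_word_le w Hw)) as E2.
    apply (Rmult_le_compat_l C) in E2; [|lra]. unfold beta. lra. }
(* The prefix [w] carries the induction: each averaging step appends one letter to it. *)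
assert (Hiter : forall n w v, Forall (fun s => In s S) w ->
  hnorm (A (word_prod mul e w) (Nat.iter n L v)) <= beta (length w + n)%nat * hnorm v).
{ induction n as [|n IH]; intros w v Hw.
  - rewrite Nat.add_0_r. apply Hword, Hw.
  - simpl Nat.iter. unfold L at 1. rewrite hmean_map by apply Hact.
    apply hmean_norm_le; [assumption|]. intros s Hs'.
    rewrite <- (linear_part_mul _ _ _ _ Hact), <- word_prod_rcons.
    replace (length w + Datatypes.S n)%nat with (length (w ++ s :: nil) + n)%nat
      by (rewrite length_app; simpl; lia).
    apply IH, Forall_app. auto. }
destruct (Rpower_INR_le_pow sigma q Hs Hq) as [K [HK0 HK]].
exists (1 + C * K). intros n v. specialize (Hiter n nil v (Forall_nil _)). simpl in Hiter.
rewrite (linear_part_one _ _ _ _ Hact) in Hiter.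
apply Rle_trans with (1 := Hiter). apply Rmult_le_compat_r; [apply hnorm_pos|].
unfold beta. specialize (HK n). apply (Rmult_le_compat_l C) in HK; [|lra].
pose proof (pow_R1_Rle q n (Rlt_le _ _ Hq)). lra.
Qed.

Lemma hmean_action_linear (H : Hilbert) rho A b :
  affine_action mul e H rho A b -> is_linear (fun v => hmean S (fun s => A s v)).
Proof.
intro Hact. split.
- intros x y. rewrite <- hmean_add. apply hmean_ext; intros. apply Hact.
- intros a x. rewrite <- hmean_scal. apply hmean_ext; intros. apply Hact.
Qed.

(** * Nonconstant harmonic maps as limits *)

Section Harmonic.

Variables (H : Hilbert) (rho A : G -> H -> H) (b : G -> H) (C sigma : R).
Hypothesis Hact : affine_action mul e H rho A b.
Hypothesis HC : 0 < C.
Hypothesis Hs : 0 <= sigma.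
Hypothesis Hbd : linear_growth_bound mul inv e S H A C sigma.
Hypothesis Hgen : forall g, exists w, Forall (fun s => In s S) w /\ word_prod mul e w = g.

Let laplacian v := hsub (hmean S (fun s => rho s v)) v.

(** At the scale of the largest generator displacement, the limit displacement of [s0] has norm 1
    while the mean displacement tends to 0, so the orbit of 0 is harmonic and nonconstant. *)
Lemma harmonic_of_small_laplacian :
  ~ (exists K, forall v s, In s S -> hnorm (hsub (rho s v) v) <= K * hnorm (laplacian v)) ->
  has_harmonic_map C sigma.
Proof.
intro Hgap.
pose (Q := fun eps s0 => exists v, 0 < hnorm (hsub (rho s0 v) v) /\
  (forall s, In s S -> hnorm (hsub (rho s v) v) <= hnorm (hsub (rho s0 v) v)) /\
  hnorm (laplacian v) <= eps * hnorm (hsub (rho s0 v) v)).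
destruct (list_pigeonhole Q S) as [s0 [Hs0 HQ]].
- intros eps eps' s He [v [Hv1 [Hv2 Hv3]]]. exists v. split; [assumption|split; [assumption|]].
  apply Rle_trans with (1 := Hv3). apply Rmult_le_compat_r; lra.
(* A violation of the gap with constant [/ eps] gives the vector; the maximal generator moves it at
   least as far as the violating one. *)
- intros eps He. apply NNPP; intro Hno. apply Hgap. exists (/ eps). intros v s Hs'.
  apply Rnot_lt_le; intro Hlt. apply Hno.
  destruct (list_argmax (fun s => hnorm (hsub (rho s v) v)) S s Hs') as [s0 [Hs0 Hmax]].
  pose proof (Hmax s Hs') as Hss0. simpl in Hss0.
  pose proof (hnorm_pos (laplacian v)). pose proof (Rinv_0_lt_compat _ He).
  exists s0. split; [assumption|]. exists v. split; [|split; [exact Hmax|]].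
  + assert (0 <= / eps * hnorm (laplacian v)) by nra. lra.
  + apply (Rmult_le_reg_l (/ eps)); [assumption|]. rewrite <- Rmult_assoc, Rinv_l; lra.
- destruct (choice (fun k v => 0 < hnorm (hsub (rho s0 v) v) /\
    (forall s, In s S -> hnorm (hsub (rho s v) v) <= hnorm (hsub (rho s0 v) v)) /\
    hnorm (laplacian v) <= / (INR k + 1) * hnorm (hsub (rho s0 v) v))) as [v Hv].
  { intro k. apply HQ. apply Rinv_0_lt_compat. pose proof (pos_INR k); lra. }
  destruct (rescaled_limit H rho A b Hact Hgen v (fun k => hnorm (hsub (rho s0 (v k)) (v k))) 1)
    as [K [A' [b' [cls [Hact' [Hgr [c1 [c2 [c0 [cb [[y [Hy cm]] _]]]]]]]]]]].
  + intro k; apply Hv.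
  + intros k s Hs'. rewrite Rmult_1_l. apply Hv, Hs'.
  + apply (harmonic_orbit K _ A' b' C sigma hzero Hact'); [apply Hgr; assumption| |].
    * transitivity (hmean S b').
      { apply hmean_ext. intros s _. rewrite (linear_zero (A' s)) by apply Hact'. hvec; ring. }
      rewrite cm, <- c0. apply c2. intros eps He.
      destruct (inv_index_small eps He) as [N HN]. exists N; intros k Hk.
      apply Rle_lt_trans with (2 := HN k Hk). destruct (Hv k) as [Hv1 [_ Hv3]].
      rewrite Hy.
      replace (hsub _ (bconst hzero k)) with
        (hscal (/ hnorm (hsub (rho s0 (v k)) (v k))) (laplacian (v k)))
        by (unfold laplacian; simpl; hvec; ring).
      pose proof (Rinv_0_lt_compat _ Hv1) as Hi.
      rewrite hnorm_scal, Rabs_pos_eq by lra.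
      apply (Rmult_le_reg_l (hnorm (hsub (rho s0 (v k)) (v k)))); [assumption|].
      rewrite <- Rmult_assoc, Rinv_r; lra.
    * exists s0. rewrite (linear_zero (A' s0)) by apply Hact'.
      destruct (cb s0) as [y0 [Hy0 cy0]]. rewrite cy0. intro E. apply (c1 y0).
      -- intro k. rewrite Hy0, hnorm_scal. destruct (Hv k) as [Hv1 _].
         pose proof (Rinv_0_lt_compat _ Hv1). rewrite Rabs_pos_eq by lra. apply Rinv_l; lra.
      -- rewrite <- E. hvec; ring.
Qed.

Let average v := hmean S (fun s => A s v).

(** The gap is the boundedness that [rescaled_limit] demands at the scale [hnorm (laplacian v)]; at
    this scale the mean of the limit cocycle is a unit vector, hence nonzero. *)
Lemma harmonic_of_gap :
  NoDup S -> (forall s, In s S -> In (inv s) S) ->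
  (exists K, forall v s, In s S -> hnorm (hsub (rho s v) v) <= K * hnorm (laplacian v)) ->
  (forall eps, 0 < eps -> exists v, laplacian v <> hzero /\
     hnorm (hsub (average (laplacian v)) (laplacian v)) <= eps * hnorm (laplacian v)) ->
  has_harmonic_map C sigma.
Proof.
intros Hnd Hsym [M HM] Hlap.
destruct (choice (fun k v => laplacian v <> hzero /\
   hnorm (hsub (average (laplacian v)) (laplacian v)) <= / (INR k + 1) * hnorm (laplacian v)))
  as [v Hv].
{ intro k. apply Hlap, Rinv_0_lt_compat. pose proof (pos_INR k); lra. }
assert (Hr : forall k, 0 < hnorm (laplacian (v k))) by (intro k; apply hnorm_neq0, Hv).
destruct (rescaled_limit H rho A b Hact Hgen v (fun k => hnorm (laplacian (v k))) M)
  as [K [A' [b' [cls [Hact' [Hgr [c1 [c2 [c0 [_ [[x [Hx cm]] cA]]]]]]]]]]].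
- exact Hr.
- intros k s Hs'. apply HM, Hs'.
- cbv beta in Hx. assert (Hw : hmean S b' <> hzero).
  { rewrite cm. apply c1. intro k. rewrite Hx, hnorm_scal. specialize (Hr k).
    change (Rabs (/ hnorm (laplacian (v k))) * hnorm (laplacian (v k)) = 1).
    pose proof (Rinv_0_lt_compat _ Hr). rewrite Rabs_pos_eq by lra. apply Rinv_l; lra. }
  assert (HLw : hmean S (fun s => A' s (hmean S b')) = hmean S b').
  { rewrite cm. destruct (cA x) as [y [Hy cy]]. rewrite cy. apply c2. intros eps He.
    destruct (inv_index_small eps He) as [N HN]. exists N; intros k Hk.
    apply Rle_lt_trans with (2 := HN k Hk). specialize (Hr k).
    pose proof (Rinv_0_lt_compat _ Hr) as Hi. destruct (Hv k) as [_ Hvk].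
    assert (Hyx : hsub (y k) (x k) = hscal (/ hnorm (laplacian (v k)))
              (hsub (average (laplacian (v k))) (laplacian (v k)))).
    { rewrite Hy, Hx. fold (laplacian (v k)). fold (average (hscal (/ hnorm (laplacian (v k))) (laplacian (v k)))).
      unfold average at 1. rewrite (proj2 (hmean_action_linear H rho A b Hact)).
      fold (average (laplacian (v k))). hvec; ring. }
    rewrite Hyx, hnorm_scal, Rabs_pos_eq by lra.
    apply (Rmult_le_reg_l (hnorm (laplacian (v k)))); [assumption|].
    rewrite <- Rmult_assoc, Rinv_r; lra. }
  assert (Hbd' : linear_growth_bound mul inv e S K A' C sigma) by (apply Hgr; assumption).
  destruct (classic (exists g, A' g (hmean S b') <> hmean S b')) as [Hg|Hg].
  + apply (harmonic_orbit K A' A' (fun _ => hzero) C sigma (hmean S b')); try assumption.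
    apply (linear_action _ _ _ _ Hact').
  + apply (harmonic_modulo_invariant K _ A' b' C sigma Hact'); try assumption.
    intro g. apply NNPP; intro Hn. apply Hg. exists g; exact Hn.
Qed.

Lemma hmean_action v : hmean S (fun s => rho s v) = hadd (average v) (hmean S b).
Proof.
unfold average. rewrite <- hmean_add. apply hmean_ext. intros; apply Hact.
Qed.

Lemma harmonic_of_no_fixed_point :
  NoDup S -> (forall s, In s S -> In (inv s) S) -> ~ has_fixed_point rho ->
  has_harmonic_map C sigma.
Proof.
intros Hnd Hsym Hfix.
pose proof (averages_subexponential H rho A b C sigma Hact HC Hs Hbd) as Hgrowth.
(* Boundedness of the average is the growth estimate for a single iterate, at the rate 2. *)
assert (exists c, 0 <= c /\ opnorm_le average c) as [c [Hc0 Hc]].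
{ destruct (Hgrowth 2) as [K HK]; [lra|]. exists (Rabs (K * 2)). split; [apply Rabs_pos|].
  intro v. specialize (HK 1%nat v). simpl in HK. unfold average.
  apply Rle_trans with (1 := HK). apply Rmult_le_compat_r; [apply hnorm_pos|].
  rewrite Rmult_1_r. apply Rle_abs. }
destruct (fixed_point_or_almost_harmonic H average c (hmean S b)
  (hmean_action_linear H rho A b Hact) Hc0 Hc Hgrowth) as [[v Hv]|Hal].
- apply (harmonic_orbit H rho A b C sigma v Hact Hbd).
  + rewrite hmean_action. exact Hv.
  + apply NNPP; intro Hno. apply Hfix. exists v. intro g. apply NNPP; intro Hg.
    apply Hno. exists g; exact Hg.
- destruct (classic (exists K, forall v s, In s S ->
    hnorm (hsub (rho s v) v) <= K * hnorm (laplacian v))) as [Hgap|Hgap].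
  + apply harmonic_of_gap; try assumption. intros eps He. destruct (Hal eps He) as [v Hv].
    exists v. unfold laplacian. rewrite hmean_action. exact Hv.
  + apply harmonic_of_small_laplacian, Hgap.
Qed.

End Harmonic.
End Action.

Theorem mainTheorem2 (G : Type) (mul : G -> G -> G) (inv : G -> G) (e : G)
  (S : list G) (H : Hilbert) (rho : G -> H -> H) (A : G -> H -> H) (b : G -> H)
  (C sigma : R) :
  is_group G mul inv e ->
  finite_symmetric_generating_set mul inv e S ->
  affine_action mul e H rho A b ->
  0 < C -> 0 <= sigma ->
  linear_growth_bound mul inv e S H A C sigma ->
  ~ has_fixed_point rho ->
  exists (H' : Hilbert) (rho' : G -> H' -> H') (A' : G -> H' -> H') (b' : G -> H'),
    affine_action mul e H' rho' A' b' /\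
    linear_growth_bound mul inv e S H' A' C sigma /\
    exists f : G -> H',
      nonconstant f /\ harmonic mul S f /\ equivariant mul rho' f.
Proof.
intros HG [Hnd [Hsym Hgen]] Hact HC Hs Hbd Hfix.
(* An empty generating set would leave only [e], which fixes every vector. *)
assert (HS : S <> nil).
{ intro E. apply Hfix. exists hzero. intro g. destruct (Hgen g) as [w [Hw <-]].
  rewrite E in Hw. destruct Hw; [apply Hact|contradiction]. }
exact (harmonic_of_no_fixed_point G mul inv e S HG HS H rho A b C sigma Hact HC Hs Hbd
  Hgen Hnd Hsym Hfix).
Qed.
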